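(* Let $T>0$ be arbitrary, let $A,C\in C([0,T];\mathbb{R}^{n\times n})$, $B,D\in C([0,T];\mathbb{R}^{n\times m})$, $G\in C([0,T];\mathbb{S}^n)$, $Q\in C([0,T]^2;\mathbb{S}^n)$, $R\in C([0,T]^2;\mathbb{S}^m)$. Assume: (i) there is a constant $\delta>0$ such that $Q(t,s)\ge 0$, $R(t,s)\ge \delta I$, $G(t)\ge 0$ for all $0\le t\le s\le T$; (ii) there are positive definite matrices $\widehat Q,\widehat R,\widehat G$ such that for all $0\le t\le r\le s\le T$, $Q(t,s)\le Q(r,s)\le\widehat Q$, $R(t,s)\le R(r,s)\le\widehat R$, $G(t)\le G(r)\le\widehat G$; (iii) $G\in C^1([0,T];\mathbb{S}^n)$, and $Q(t,s)$ and $R(t,s)$ are continuously differentiable with respect to $t$ over $\{(t,s): 0\le t\le s\le T\}$. Then the equilibrium Riccati equation $$\begin{cases}\partial_sP(t,s)+P(t,s)A_\Theta(s)+A_\Theta(s)^\top P(t,s)+C_\Theta(s)^\top P(t,s)C_\Theta(s)\\ \qquad+Q(t,s)+\Theta(s)^\top R(t,s)\Theta(s)=0,\quad 0\le t\le s\le T,\\ P(t,T)=G(t),\quad 0\le t\le T,\end{cases}$$ where $$\Theta(s)=-[R(s,s)+D(s)^\top P(s,s)D(s)]^{-1}[B(s)^\top P(s,s)+D(s)^\top P(s,s)C(s)],$$ $$A_\Theta(s)=A(s)+B(s)\Theta(s),\qquad C_\Theta(s)=C(s)+D(s)\Theta(s),$$ admits a unique solution $P\in C(\Delta^*[0,T];\mathbb{S}^n_+)$.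 Moreover, for this solution $P$, the function $\Theta(s)=-[R(s,s)+D(s)^\top P(s,s)D(s)]^{-1}[B(s)^\top P(s,s)+D(s)^\top P(s,s)C(s)]$, $s\in[0,T]$, belongs to $C([0,T];\mathbb{R}^{m\times n})$.
   Context: $\mathbb{S}^n$ is the space of symmetric real $n\times n$ matrices, $\mathbb{S}^n_+$ the subset of positive semi-definite ones, and inequalities between symmetric matrices are in the positive semi-definite (Loewner) order. For $0\le t_1\le t_2\le T$, $\Delta^*[t_1,t_2]=\{(t,s)\in[t_1,t_2]^2: t\le s\}$; $C(\Delta^*[t_1,t_2];\mathbb{S}^n_+)$ is the set of continuous functions on $\Delta^*[t_1,t_2]$ with values in $\mathbb{S}^n_+$. The equation is non-local: the coefficient $\Theta(s)$ depends on the unknown $P$ through its diagonal value $P(s,s)$. A solution is a function $P$ such that, for each $t$, $s\mapsto P(t,s)$ is differentiable on $[t,T]$ and satisfies the displayed equation and terminal condition. *)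

(* Defs.v *)
From mathcomp Require Export all_boot all_order all_algebra.
From mathcomp Require Export all_classical all_reals all_analysis.
Export Order.TTheory GRing.Theory Num.Theory.
Export numFieldNormedType.Exports.

Set Implicit Arguments.
Unset Strict Implicit.
Unset Printing Implicit Defensive.

Local Open Scope classical_set_scope.
Local Open Scope ring_scope.

Section Matrices.
Context {K : realType} {n : nat}.
Implicit Types M N : 'M[K]_n.

Definition Sym : set 'M[K]_n := [set M | M^T = M].

Definition SymPos : set 'M[K]_n :=
  [set M | Sym M /\ forall x : 'cV[K]_n, 0 <= (x^T *m M *m x) 0 0].

Definition posdef M : Prop :=
  Sym M /\ forall x : 'cV[K]_n, x != 0 -> 0 < (x^T *m M *m x) 0 0.

Definition loewner_le M N : Prop := SymPos (N - M).

End Matrices.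

Notation "M <=L N" := (loewner_le M N) (at level 70, no associativity).

Section Regularity.
Context {K : realType}.

(* The class C(D; S) of continuous functions on D with values in S; values
   outside D are irrelevant. *)
Definition cont_fun {U V : topologicalType} (D : set U) (S : set V)
    (f : U -> V) : Prop :=
  {within D, continuous f} /\ forall x, D x -> S (f x).

(* l is the derivative of f at x relative to D: one-sided at the endpoints when
   D is an interval, and vacuous when x is isolated in D. *)
Definition has_derivative_in {V : normedModType K} (D : set K)
    (f : K -> V) (x : K) (l : V) : Prop :=
  (y - x)^-1 *: (f y - f x) @[y --> within D x^'] --> l.

Definition C1_fun {V : normedModType K} (D : set K) (f : K -> V) : Prop :=
  exists2 df : K -> V,
    {within D, continuous df} &
    forall x, D x -> has_derivative_in D f x (df x).

Definition Delta (t1 t2 : K) : set (K * K) :=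
  [set x | [/\ t1 <= x.1 <= t2, t1 <= x.2 <= t2 & x.1 <= x.2]].

(* The difference quotients in t only involve points of the triangle, so t
   ranges over [0, s]; the derivative is continuous up to the corner (0, 0),
   where that interval is a single point. *)
Definition C1_first_var {V : normedModType K} (T : K) (f : K * K -> V) : Prop :=
  exists2 df : K * K -> V,
    {within Delta 0 T, continuous df} &
    forall t s, Delta 0 T (t, s) ->
      has_derivative_in `[0, s] (fun r => f (r, s)) t (df (t, s)).

End Regularity.

Section EquilibriumRiccati.
Context {K : realType} {n m : nat}.
Context (A C : K -> 'M[K]_n) (B D : K -> 'M[K]_(n, m)) (G : K -> 'M[K]_n).
Context (Q : K * K -> 'M[K]_n) (R : K * K -> 'M[K]_m).
Context (T : K) (P : K * K -> 'M[K]_n).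

Definition Theta (s : K) : 'M[K]_(m, n) :=
  - invmx (R (s, s) + (D s)^T *m P (s, s) *m D s)
    *m ((B s)^T *m P (s, s) + (D s)^T *m P (s, s) *m C s).

Definition A_Theta (s : K) : 'M[K]_n := A s + B s *m Theta s.
Definition C_Theta (s : K) : 'M[K]_n := C s + D s *m Theta s.

(* At t = s = T the interval [t, T] is a single point and the differential
   equation imposes nothing beyond the terminal condition. *)
Definition riccati_equation : Prop :=
  (forall t s, Delta 0 T (t, s) ->
     exists2 dP : 'M[K]_n,
       has_derivative_in `[t, T] (fun r => P (t, r)) s dP &
       dP + P (t, s) *m A_Theta s + (A_Theta s)^T *m P (t, s)
          + (C_Theta s)^T *m P (t, s) *m C_Theta s
          + Q (t, s) + (Theta s)^T *m R (t, s) *m Theta s = 0)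
  /\ (forall t, 0 <= t <= T -> P (t, T) = G t).

Definition riccati_solution : Prop :=
  cont_fun (Delta 0 T) SymPos P /\ riccati_equation.

End EquilibriumRiccati.

(* Main.v *)
(* The diagonal p(s) = P(s,s) is the only part of P entering the feedback, and
   for a positive semidefinite p that feedback minimizes the right-hand side of
   the equation among all feedbacks. Since Q, R and G increase in t, so does P,
   by positivity of linear Lyapunov equations; hence p(s - h) <= P(s,s - h) once
   the equation is extended beyond the triangle, and running time backwards p
   grows at most as fast as under the zero feedback.
   This bounds p a priori by the solution of a scalar linear equation.

   Existence follows by cutting the nonlinearity off outside a ball: the
   cut-off equation has a globally Lipschitz right-hand side, so Picard iteration
   in a norm weighted by exp(2L(T - s)) converges. The cut-off replaces the
   feedback by a multiple of it with factor in [0,1], which preserves the a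
   priori bound, so the cut-off is inactive for a large enough ball. The same
   weighted contraction on the triangle gives uniqueness. *)

(* The feedback formula is guaranteed to make sense only for positive p, whereas positivity of P is
   itself a property of the solution. The circle is broken by regarding the feedback, once the
   cut-off equation is solved, as a known bounded function of time: every slice P(t, .) then solves
   a linear Lyapunov equation, and positivity and monotonicity in t follow without any formula for
   the feedback. For this the cut-off field must be defined and Lipschitz on all matrices, hence a
   regularized inverse that agrees with the true one on coercive matrices.

   Two radii occur. The feedback is truncated at the a priori bound of the diagonal, which depends
   on the data only; the argument that enters linearly is truncated at a second radius, which
   Gronwall's inequality provides from the resulting bound on the feedback.

   The equation controls P in s only, so the diagonal has no differential equation of its own. Its
   growth is bounded by continuous induction in reversed time: advance with t frozen, then lower t
   by monotonicity.

   Doubled exponential rates make each integration halve the error, so Gronwall, Picard and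
   uniqueness all reduce to geometric decay. *)
From mathcomp Require Import perm ring lra.
Require Import Defs.

Set Implicit Arguments.
Unset Strict Implicit.
Unset Printing Implicit Defensive.

Local Open Scope classical_set_scope.
Local Open Scope ring_scope.

(** * Bounded Lipschitz matrix functions *)

Section MatrixNorm.
Context {K : realType}.

Lemma mx_norm_entry p q (M : 'M[K]_(p, q)) i j : `|M i j| <= `|M|.
Proof.
rewrite [leRHS]/Num.norm /= mx_normrE.
by apply/bigmax_geP; right; exists (i, j).
Qed.

Lemma mx_norm_le p q (M : 'M[K]_(p, q)) e :
  0 <= e -> (forall i j, `|M i j| <= e) -> `|M| <= e.
Proof.
move=> e0 Me; rewrite [leLHS]/Num.norm /= mx_normrE.
by apply/bigmax_leP; split => // -[i j] _; exact: Me.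
Qed.

Lemma mx_norm_tr p q (M : 'M[K]_(p, q)) : `|M^T| = `|M|.
Proof.
by apply/eqP; rewrite eq_le; apply/andP; split;
  apply: mx_norm_le => // i j; rewrite ?mxE -?[M i j]trmxK;
  [exact: mx_norm_entry|rewrite -[M in leLHS]trmxK mxE; exact: mx_norm_entry].
Qed.

Lemma mx_norm_mul p q r (M : 'M[K]_(p, q)) (N : 'M[K]_(q, r)) :
  `|M *m N| <= q%:R * (`|M| * `|N|).
Proof.
apply: mx_norm_le => [|i j]; first by rewrite !mulr_ge0.
rewrite mxE (le_trans (ler_norm_sum _ _ _))//.
rewrite (@le_trans _ _ (\sum_(k < q) `|M| * `|N|))//.
  by apply: ler_sum => k _; rewrite normrM ler_pM// mx_norm_entry.
by rewrite sumr_const card_ord mulr_natl.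
Qed.

Lemma cvg_mx_entries (T : Type) (F : set_system T) (FF : Filter F) p q
    (f : T -> 'M[K]_(p, q)) (l : 'M[K]_(p, q)) :
  (forall i j, f x i j @[x --> F] --> l i j) -> f x @[x --> F] --> l.
Proof.
move=> fl A [P Pl PA].
apply: (filterS (P := fun x => forall ij : 'I_p * 'I_q,
    P ij.1 ij.2 (f x ij.1 ij.2))).
  by move=> x xP; apply: PA => i j; exact: (xP (i, j)).
apply: (@filter_forall _ ('I_p * 'I_q)%type
  (fun ij x => P ij.1 ij.2 (f x ij.1 ij.2))) => -[i j].
by apply: (fl i j); exact: Pl.
Qed.

Lemma cvg_entry (T : Type) (F : set_system T) (FF : Filter F) p q
    (f : T -> 'M[K]_(p, q)) (l : 'M[K]_(p, q)) i j :
  f x @[x --> F] --> l -> f x i j @[x --> F] --> l i j.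
Proof.
move=> fl; apply: (@cvg_comp _ _ _ f (fun M : 'M[K]_(p, q) => M i j) _ _ _ fl).
exact: coord_continuous.
Qed.

End MatrixNorm.

Section BoundedLipschitz.
Context {K : realType} {Z : topologicalType} {W : normedModType K}.
Implicit Types f g : Z -> W -> K.

(** Here [z] is time, which enters only continuously, and [w] is the unknown. Boundedness is carried
    along because products of Lipschitz functions stay Lipschitz only when the factors are bounded;
    the class is then closed under all operations that build the right-hand side. *)
Definition bounded_lipschitz f : Prop :=
  [/\ continuous (fun x : Z * W => f x.1 x.2),
      exists2 L : K, 0 <= L & forall z w, `|f z w| <= L &
      exists2 L : K, 0 <= L &
        forall z w w', `|f z w - f z w'| <= L * `|w - w'|].

Local Notation BL := bounded_lipschitz.

Lemma BL_param (a : Z -> K) :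
  continuous a -> (exists L, forall z, `|a z| <= L) -> BL (fun z _ => a z).
Proof.
move=> ac [L aL]; split.
- by move=> x; apply: (@continuous_comp _ _ _ fst a); [exact: cvg_fst|exact: ac].
- by exists `|L| => // z w; rewrite (le_trans (aL z))// ler_norm.
- by exists 0 => // z w w'; rewrite subrr normr0 mul0r.
Qed.

Lemma BL_cst (c : K) : BL (fun _ _ => c).
Proof. by apply: BL_param; [exact: cst_continuous|exists `|c|]. Qed.

Lemma BL_add f g : BL f -> BL g -> BL (fun z w => f z w + g z w).
Proof.
move=> [fc [B B0 fB] [L L0 fL]] [gc [B' B'0 gB] [L' L'0 gL]]; split.
- by move=> x; apply: cvgD; [exact: fc|exact: gc].
- exists (B + B') => [|z w]; first exact: addr_ge0.
  by rewrite (le_trans (ler_normD _ _))// lerD.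
- exists (L + L') => [|z w w']; first exact: addr_ge0.
  by rewrite opprD addrACA (le_trans (ler_normD _ _))// mulrDl lerD.
Qed.

Lemma BL_opp f : BL f -> BL (fun z w => - f z w).
Proof.
move=> [fc [B B0 fB] [L L0 fL]]; split.
- by move=> x; apply: cvgN; exact: fc.
- by exists B => // z w; rewrite normrN.
- by exists L => // z w w'; rewrite -opprD normrN.
Qed.

Lemma BL_mul f g : BL f -> BL g -> BL (fun z w => f z w * g z w).
Proof.
move=> [fc [B B0 fB] [L L0 fL]] [gc [B' B'0 gB] [L' L'0 gL]]; split.
- by move=> x; apply: cvgM; [exact: fc|exact: gc].
- exists (B * B') => [|z w]; first exact: mulr_ge0.
  by rewrite normrM ler_pM.
- exists (L * B' + B * L') => [|z w w']; first by rewrite addr_ge0// mulr_ge0.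
  have -> : f z w * g z w - f z w' * g z w' =
    (f z w - f z w') * g z w + f z w' * (g z w - g z w') by ring.
  rewrite (le_trans (ler_normD _ _))// [leRHS]mulrDl lerD// normrM.
    by rewrite mulrAC ler_pM.
  by rewrite -mulrA ler_pM.
Qed.

Lemma BL_sum (I : Type) (r : seq I) (P : pred I) (f : I -> Z -> W -> K) :
  (forall i, BL (f i)) -> BL (fun z w => \sum_(i <- r | P i) f i z w).
Proof.
move=> fB; elim: r => [|i r IH].
  rewrite [X in BL X](_ : _ = fun _ _ => 0); first exact: BL_cst.
  by apply/funext => z; apply/funext => w; rewrite big_nil.
have [Pi|Pi] := boolP (P i).
  rewrite [X in BL X](_ : _ =
    fun z w => f i z w + \sum_(i <- r | P i) f i z w); first exact: BL_add.
  by apply/funext => z; apply/funext => w; rewrite big_cons Pi.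
rewrite [X in BL X](_ : _ = fun z w => \sum_(i <- r | P i) f i z w)//.
by apply/funext => z; apply/funext => w; rewrite big_cons (negbTE Pi).
Qed.

Lemma BL_prod (I : Type) (r : seq I) (P : pred I) (f : I -> Z -> W -> K) :
  (forall i, BL (f i)) -> BL (fun z w => \prod_(i <- r | P i) f i z w).
Proof.
move=> fB; elim: r => [|i r IH].
  rewrite [X in BL X](_ : _ = fun _ _ => 1); first exact: BL_cst.
  by apply/funext => z; apply/funext => w; rewrite big_nil.
have [Pi|Pi] := boolP (P i).
  rewrite [X in BL X](_ : _ =
    fun z w => f i z w * \prod_(i <- r | P i) f i z w); first exact: BL_mul.
  by apply/funext => z; apply/funext => w; rewrite big_cons Pi.
rewrite [X in BL X](_ : _ = fun z w => \prod_(i <- r | P i) f i z w)//.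
by apply/funext => z; apply/funext => w; rewrite big_cons (negbTE Pi).
Qed.

Lemma maxr_lipschitz (x y c : K) : `|Num.max x c - Num.max y c| <= `|x - y|.
Proof.
rewrite ler_norml; have := ler_norm (x - y); have := ler_norm (y - x).
rewrite (distrC y x) => h1 h2.
by have [h|h] := leP x c; have [h'|h'] := leP y c; apply/andP; split; lra.
Qed.

Lemma minr_lipschitz (x y c : K) : `|Num.min x c - Num.min y c| <= `|x - y|.
Proof.
rewrite ler_norml; have := ler_norm (x - y); have := ler_norm (y - x).
rewrite (distrC y x) => h1 h2.
by have [h|h] := leP x c; have [h'|h'] := leP y c; apply/andP; split; lra.
Qed.

Lemma BL_max f c : BL f -> BL (fun z w => Num.max (f z w) c).
Proof.
move=> [fc [B B0 fB] [L L0 fL]]; split.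
- by move=> x; apply: continuous_max; [exact: fc|exact: cst_continuous].
- exists (Num.max B `|c|) => [|z w]; first by rewrite le_max B0.
  by rewrite le_max; have [_|_] := leP (f z w) c; rewrite ?fB ?lexx ?orbT.
- by exists L => // z w w'; rewrite (le_trans (maxr_lipschitz _ _ _)).
Qed.

Lemma BL_inv f c : 0 < c -> (forall z w, c <= f z w) -> BL f ->
  BL (fun z w => (f z w)^-1).
Proof.
move=> c0 cf [fc [B B0 fB] [L L0 fL]].
have f0 z w : 0 < f z w by exact: lt_le_trans (cf z w).
have fV z w : `|(f z w)^-1| <= c^-1.
  by rewrite gtr0_norm ?invr_gt0// lef_pV2// posrE.
split.
- by move=> x; apply: cvgV; [by rewrite gt_eqF|exact: fc].
- by exists c^-1 => //; rewrite invr_ge0 ltW.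
- exists (c^-1 * c^-1 * L) => [|z w w'].
    by rewrite !mulr_ge0// invr_ge0 ltW.
  have -> : (f z w)^-1 - (f z w')^-1 =
      (f z w)^-1 * (f z w')^-1 * (f z w' - f z w).
    by field; rewrite !gt_eqF.
  rewrite normrM -[leRHS]mulrA; apply: ler_pM => //; last by rewrite distrC.
  by rewrite normrM; apply: ler_pM => //; exact: fV.
Qed.

Definition clamp (a b x : K) : K := Num.max (Num.min x b) a.

Lemma clamp_lipschitz a b (x y : K) : `|clamp a b x - clamp a b y| <= `|x - y|.
Proof. exact: le_trans (maxr_lipschitz _ _ _) (minr_lipschitz _ _ _). Qed.

Lemma clampP a b x : a <= b -> a <= clamp a b x <= b.
Proof. by move=> ab; rewrite /clamp le_max lexx orbT/= ge_max ge_min lexx orbT. Qed.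

Lemma clamp_id a b x : a <= x <= b -> clamp a b x = x.
Proof. by move=> /andP[ax xb]; rewrite /clamp min_l// max_l. Qed.

Lemma clamp_continuous a b : continuous (clamp a b).
Proof.
move=> x; apply: (continuous_max (f := fun y => Num.min y b) (g := fun=> a)).
  apply: (continuous_min (f := id) (g := fun=> b)); [exact: cvg_id|exact: cst_continuous].
exact: cst_continuous.
Qed.

(** This is how the unknown enters the class: a coordinate of [w] or its norm is Lipschitz but
    unbounded. *)
Lemma BL_clamp a b (g : W -> K) (L : K) : a <= b -> 0 <= L ->
  (forall w w', `|g w - g w'| <= L * `|w - w'|) ->
  BL (fun _ w => clamp a b (g w)).
Proof.
move=> ab L0 gL; split.
- move=> x; apply: (@continuous_comp _ _ _ snd (fun w => clamp a b (g w))).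
    exact: cvg_snd.
  apply: (@continuous_comp _ _ _ g (clamp a b)); last exact: clamp_continuous.
  apply/cvgrPdist_le => e e0; apply/nbhs_ballP.
  exists (e / (L + 1)) => [/=|w /= ball_w]; first by rewrite divr_gt0// ltr_wpDl.
  rewrite (le_trans (gL _ _))//; move: ball_w; rewrite -ball_normE /= => /ltW.
  rewrite ler_pdivlMr ?ltr_wpDl// => h; apply: le_trans h.
  by rewrite mulrC ler_wpM2l// lerDl.
- exists (`|a| + `|b|) => [|_ w]; first by rewrite addr_ge0.
  have /andP[h1 h2] := clampP (g w) ab.
  rewrite ler_norml; have := ler_norm b; have := ler_norm (- a).
  by rewrite normrN => ? ?; have := normr_ge0 a; have := normr_ge0 b; lra.
- by exists L => // _ w w'; rewrite (le_trans (clamp_lipschitz _ _ _ _)).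
Qed.

End BoundedLipschitz.

Section BoundedLipschitzMatrix.
Context {K : realType} {Z : topologicalType} {W : normedModType K}.

Definition bounded_lipschitz_mx p q (f : Z -> W -> 'M[K]_(p, q)) : Prop :=
  forall i j, bounded_lipschitz (fun z w => f z w i j).

Local Notation BL := bounded_lipschitz.
Local Notation BLM := bounded_lipschitz_mx.

Lemma eq_BL (f g : Z -> W -> K) : (forall z w, f z w = g z w) -> BL f -> BL g.
Proof.
move=> fg; rewrite (_ : f = g)//.
by apply/funext => z; apply/funext => w.
Qed.

Lemma BLM_param p q (a : Z -> 'M[K]_(p, q)) :
  continuous a -> (exists L, forall z, `|a z| <= L) -> BLM (fun z _ => a z).
Proof.
move=> ac [L aL] i j; apply: BL_param; first by move=> z; apply: cvg_entry; exact: ac.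
by exists L => z; rewrite (le_trans (mx_norm_entry _ _ _)).
Qed.

Lemma BLM_add p q (f g : Z -> W -> 'M[K]_(p, q)) :
  BLM f -> BLM g -> BLM (fun z w => f z w + g z w).
Proof.
move=> fB gB i j; apply: eq_BL (BL_add (fB i j) (gB i j)) => z w.
by rewrite mxE.
Qed.

Lemma BLM_opp p q (f : Z -> W -> 'M[K]_(p, q)) :
  BLM f -> BLM (fun z w => - f z w).
Proof.
by move=> fB i j; apply: eq_BL (BL_opp (fB i j)) => z w; rewrite mxE.
Qed.

Lemma BLM_scale p q (a : Z -> W -> K) (f : Z -> W -> 'M[K]_(p, q)) :
  BL a -> BLM f -> BLM (fun z w => a z w *: f z w).
Proof.
by move=> aB fB i j; apply: eq_BL (BL_mul aB (fB i j)) => z w; rewrite mxE.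
Qed.

Lemma BLM_mul p q r (f : Z -> W -> 'M[K]_(p, q)) (g : Z -> W -> 'M[K]_(q, r)) :
  BLM f -> BLM g -> BLM (fun z w => f z w *m g z w).
Proof.
move=> fB gB i j.
apply: eq_BL (BL_sum (index_enum 'I_q) xpredT
  (fun k => BL_mul (fB i k) (gB k j))) => z w.
by rewrite mxE.
Qed.

Lemma BLM_tr p q (f : Z -> W -> 'M[K]_(p, q)) :
  BLM f -> BLM (fun z w => (f z w)^T).
Proof. by move=> fB i j; apply: eq_BL (fB j i) => z w; rewrite mxE. Qed.

Lemma BL_det p (f : Z -> W -> 'M[K]_p) : BLM f -> BL (fun z w => \det (f z w)).
Proof.
move=> fB.
apply: (@eq_BL (fun z w => \sum_(s : 'S_p) (-1) ^+ s * \prod_i f z w i (s i))).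
  by [].
apply: BL_sum => s; apply: BL_mul; first exact: BL_cst.
by apply: BL_prod => i; exact: fB.
Qed.

Lemma BLM_adj p (f : Z -> W -> 'M[K]_p) : BLM f -> BLM (fun z w => \adj (f z w)).
Proof.
move=> fB i j.
have fB' : BLM (fun z w => row' j (col' i (f z w))).
  by move=> k l; apply: eq_BL (fB (lift j k) (lift i l)) => z w; rewrite !mxE.
apply: eq_BL (BL_mul (BL_cst ((-1) ^+ (j + i))) (BL_det fB')) => z w.
by rewrite mxE.
Qed.

Lemma BLM_clamp p q (M : K) (g : W -> 'M[K]_(p, q)) (L : K) : 0 <= M -> 0 <= L ->
  (forall w w', `|g w - g w'| <= L * `|w - w'|) ->
  BLM (fun _ w => map_mx (clamp (- M) M) (g w)).
Proof.
move=> M0 L0 gL i j.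
have := @BL_clamp K Z W (- M) M (fun w => g w i j) L.
move=> /(_ _ L0) h; apply: eq_BL (h _ _) => [z w|//|w w']; rewrite ?mxE//.
  by rewrite (le_trans _ M0)// oppr_le0.
apply: le_trans (gL w w'); apply: le_trans (mx_norm_entry _ i j).
by rewrite !mxE.
Qed.

(** The entrywise constants are summed, which dominates each of them; the added 1 makes the result
    strictly positive, so that later estimates can cancel it. *)
Lemma BLM_norm p q (f : Z -> W -> 'M[K]_(p, q)) : BLM f ->
  [/\ continuous (fun x : Z * W => f x.1 x.2),
      exists2 L : K, 0 < L & forall z w, `|f z w| <= L &
      exists2 L : K, 0 < L &
        forall z w w', `|f z w - f z w'| <= L * `|w - w'|].
Proof.
move=> fB; split.
- move=> x; apply: cvg_mx_entries => i j.
  by have [fc _ _] := fB i j; exact: fc.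
- have /choice[L Lf] : forall ij : 'I_p * 'I_q, exists L : K,
      0 <= L /\ forall z w, `|f z w ij.1 ij.2| <= L.
    by move=> [i j]; have [_ [L L0 fL] _] := fB i j; exists L.
  have L0 : 0 <= \sum_ij L ij by apply: sumr_ge0 => ij _; exact: (Lf ij).1.
  exists (1 + \sum_ij L ij) => [|z w]; first by rewrite ltr_pwDl.
  apply: mx_norm_le => [|i j]; first by rewrite addr_ge0.
  rewrite (le_trans ((Lf (i, j)).2 z w))// (bigD1 (i, j))//=.
  rewrite addrCA lerDl addr_ge0//.
  by apply: sumr_ge0 => ij _; exact: (Lf ij).1.
- have /choice[L Lf] : forall ij : 'I_p * 'I_q, exists L : K,
      0 <= L /\ forall z w w', `|f z w ij.1 ij.2 - f z w' ij.1 ij.2| <= L * `|w - w'|.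
    by move=> [i j]; have [_ _ [L L0 fL]] := fB i j; exists L.
  have L0 : 0 <= \sum_ij L ij by apply: sumr_ge0 => ij _; exact: (Lf ij).1.
  exists (1 + \sum_ij L ij) => [|z w w']; first by rewrite ltr_pwDl.
  apply: mx_norm_le => [|i j]; first by rewrite mulr_ge0// addr_ge0.
  rewrite !mxE (le_trans ((Lf (i, j)).2 z w w'))// ler_wpM2r//.
  rewrite (bigD1 (i, j))//= addrCA lerDl addr_ge0//.
  by apply: sumr_ge0 => ij _; exact: (Lf ij).1.
Qed.

End BoundedLipschitzMatrix.

(** * Mean value inequality and primitives *)

Section Calculus.
Context {K : realType}.

(** The iteration arguments below all end with an error a / 2^j for every j, which this removes by
    the Archimedean property and j < 2^j. *)
Lemma le_geometric_slack (x y a : K) :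
  (forall j, x <= y + a / 2 ^+ j) -> x <= y.
Proof.
move=> h; rewrite leNgt; apply/negP => yx.
have d0 : 0 < x - y by rewrite subr_gt0.
have := archi_boundP (normr_ge0 (a / (x - y))).
set j := Num.bound _ => jlt.
have j2 : j%:R < 2 ^+ j :> K by rewrite -natrX ltr_nat ltn_expl.
have := h j; rewrite leNgt => /negP; apply.
rewrite -ltrBrDl ltr_pdivrMr ?exprn_gt0//.
have : a / (x - y) < 2 ^+ j by rewrite (le_lt_trans (ler_norm _))// (lt_trans jlt).
by rewrite ltr_pdivrMr// mulrC.
Qed.

Lemma geometric_uniform_limit (U : topologicalType) p q
    (u : nat -> U -> 'M[K]_(p, q)) (W : K) :
  (forall k, continuous (u k)) ->
  (forall k x, `|u k.+1 x - u k x| <= W / 2 ^+ k) ->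
  exists2 v : U -> 'M[K]_(p, q), continuous v &
    forall k x, `|v x - u k x| <= 2 * W / 2 ^+ k.
Proof.
move=> uc uW.
(* The exact partial sum of the geometric series is kept, since the cruder bound [2 * W / 2 ^+ k]
   would not pass through the induction on [j]. *)
have tail k j x : `|u (k + j)%N x - u k x| <= 2 * W / 2 ^+ k - 2 * W / 2 ^+ (k + j).
  elim: j => [|j IH]; first by rewrite addn0 !subrr normr0.
  rewrite addnS -(subrKA (u (k + j)%N x)) (le_trans (ler_normD _ _))//.
  rewrite (le_trans (lerD (uW _ _) IH))// exprS.
  set E := 2 ^+ (k + j); have E0 : E != 0 by rewrite expf_neq0.
  rewrite (_ : W / E + (2 * W / 2 ^+ k - 2 * W / E) =
    2 * W / 2 ^+ k - 2 * W / (2 * E))//.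
  by field; rewrite E0 expf_neq0 ?pnatr_eq0.
(* Over an empty [U] the constant [W] could be negative, so its sign is drawn from a point. *)
have W0 : U -> 0 <= W.
  by move=> x; have := le_trans (normr_ge0 _) (uW 0%N x); rewrite expr0 divr1.
have tail' k j x : (k <= j)%N -> `|u j x - u k x| <= 2 * W / 2 ^+ k.
  move=> kj; rewrite -(subnKC kj) (le_trans (tail _ _ _))// lerBlDr lerDl.
  by rewrite divr_ge0 ?mulr_ge0 ?(W0 x)// exprn_ge0.
have small (e : K) : 0 < e -> exists k, 2 * W / 2 ^+ k <= e.
  move=> e0; apply: contrapT => /forallNP h.
  have : e <= 0.
    apply: (@le_geometric_slack _ _ (2 * W)) => j.
    by rewrite add0r ltW// ltNge; apply/negP/h.
  by rewrite leNgt e0.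
have ucv x : cvg (u ^~ x @ \oo).
  apply: cauchy_cvg; apply: cauchy_exP => e e0.
  have [k ke] := small (e / 2) (divr_gt0 e0 (ltr0Sn _ 1)).
  exists (u k x), k => // j kj; rewrite -ball_normE /= distrC.
  by rewrite (le_lt_trans (tail' _ _ _ kj))// (le_lt_trans ke)//; clear -e0; lra.
pose v x := lim (u ^~ x @ \oo).
have vu k x : `|v x - u k x| <= 2 * W / 2 ^+ k.
  apply/ler_addgt0Pr => e e0.
  have : \forall j \near \oo, `|v x - u j x| <= e.
    exact: ((cvgrPdist_le _ _).1 (ucv x) e e0).
  move=> nv; near \oo => j.
  rewrite -(subrKA (u j x)) [leRHS]addrC (le_trans (ler_normD _ _))// lerD//.
    by near: j.
  by apply: tail'; near: j; exists k.
exists v => // x; apply/cvgrPdist_le => e e0.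
have [k ke] := small (e / 3) (divr_gt0 e0 (ltr0Sn _ 2)).
have nu : \forall y \near x, `|u k x - u k y| <= e / 3.
  exact: ((cvgrPdist_le _ _).1 (uc k x) (e / 3) (divr_gt0 e0 (ltr0Sn _ 2))).
apply: filterS nu => y uxy.
rewrite -(subrKA (u k x)) (le_trans (ler_normD _ _))//.
rewrite -(subrKA (u k y) (u k x)).
have h1 := le_trans (vu k x) ke; have h2 := le_trans (vu k y) ke.
rewrite distrC in h2.
rewrite (le_trans (lerD h1 (le_trans (ler_normD _ _) (lerD uxy h2))))//.
by clear -e0; lra.
Unshelve. all: by end_near. Qed.

Lemma mvt_le (f f' g g' : K -> K) a b : a <= b ->
  {within `[a, b], continuous f} -> {within `[a, b], continuous g} ->
  (forall x, x \in `]a, b[ -> is_derive x 1 f (f' x)) ->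
  (forall x, x \in `]a, b[ -> is_derive x 1 g (g' x)) ->
  (forall x, x \in `]a, b[ -> f' x <= g' x) ->
  f b - f a <= g b - g a.
Proof.
rewrite le_eqVlt => /predU1P[<-|ab] fc gc df dg fg; first by rewrite !subrr.
have hc : {within `[a, b], continuous (g - f)}.
  by move=> x; apply: cvgB; [exact: gc|exact: fc].
have [x xab h] := @MVT K (g - f) (fun x => g' x - f' x) a b ab
  (fun x xab => is_deriveB (dg x xab) (df x xab)) hc.
have {}h : (g b - f b) - (g a - f a) = (g' x - f' x) * (b - a) by exact: h.
rewrite -subr_ge0 (_ : _ - _ = (g b - f b) - (g a - f a)); last by ring.
by rewrite h mulr_ge0// subr_ge0 ?fg// ltW.
Qed.

(** Derivatives are taken entrywise so that the scalar mean value theorem and the scalar rules apply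
    directly. *)
Definition mx_derive p q (f : K -> 'M[K]_(p, q)) (x : K) (l : 'M[K]_(p, q)) :=
  forall i j, is_derive x 1 (fun r => f r i j) (l i j).

Lemma mx_derive_continuous p q (f : K -> 'M[K]_(p, q)) x l :
  mx_derive f x l -> {for x, continuous f}.
Proof.
move=> fl; apply: cvg_mx_entries => i j.
have /derivable1_diffP/differentiable_continuous h := @ex_derive _ _ _ _ _ _ _ (fl i j).
exact: h.
Qed.

(** The norm is the largest entry, so the scalar inequality for each entry and its opposite
    suffices. Allowing a majorant [g] instead of a constant lets exponential weights be used without
    integrals. *)
Lemma mx_mvt_le p q (f f' : K -> 'M[K]_(p, q)) (g g' : K -> K) a b : a <= b ->
  {within `[a, b], continuous f} -> {within `[a, b], continuous g} ->
  (forall x, x \in `]a, b[ -> mx_derive f x (f' x)) ->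
  (forall x, x \in `]a, b[ -> is_derive x 1 g (g' x)) ->
  (forall x, x \in `]a, b[ -> `|f' x| <= g' x) ->
  `|f b - f a| <= g b - g a.
Proof.
move=> ab fc gc df dg fg; apply: mx_norm_le => [|i j].
  (* A matrix may have no entries, so the right-hand side must be shown nonnegative separately; it
     is, because [g'] dominates a norm. *)
  have := @mvt_le (cst 0) (cst 0) g g' a b ab; rewrite /= subrr; apply => //.
  - by apply: continuous_subspaceT => x; exact: cst_continuous.
  - by move=> x xab; rewrite (le_trans _ (fg x xab)).
have fijc : {within `[a, b], continuous (fun r => f r i j)}.
  by move=> x; apply: cvg_entry; exact: fc.
rewrite !mxE ler_norml; apply/andP; split; last first.
  apply: (@mvt_le (fun r => f r i j) (fun r => f' r i j) g g') => //.
    by move=> x xab; exact: df.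
  by move=> x xab; rewrite (le_trans (ler_norm _))// (le_trans (mx_norm_entry _ i j))// fg.
rewrite lerNl.
have -> : - (f b i j - f a i j) = (- f b i j) - (- f a i j) by ring.
apply: (@mvt_le (fun r => - f r i j) (fun r => - f' r i j) g g') => //.
- by move=> x; apply: cvgN; exact: fijc.
- by move=> x xab; apply: is_deriveN; exact: df.
- move=> x xab; rewrite (le_trans (ler_norm _))// normrN.
  by rewrite (le_trans (mx_norm_entry _ i j))// fg.
Qed.

End Calculus.

Section Primitives.
Context {K : realType}.

Lemma is_derive_ext (f g : K -> K) (x l l' : K) : (forall y, f y = g y) ->
  l = l' -> is_derive x 1 f l -> is_derive x 1 g l'.
Proof. by move=> /funext -> ->. Qed.

Lemma is_derive_exp (k c x : K) :
  is_derive x (1 : K) (fun y => k * expR (c * y)) (c * (k * expR (c * x))).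
Proof.
have h1 : is_derive x (1 : K) (fun y => c * y) c.
  by apply: is_derive_ext (is_deriveZ c (is_derive_id x (1 : K))) => //; rewrite scaler1.
have h2 := @is_derive1_comp _ expR (fun y => c * y) x _ _ (is_derive_expR (c * x)) h1.
apply: is_derive_ext (is_deriveZ k h2) => //.
by rewrite /GRing.scale/=; ring.
Qed.

Lemma is_derive_lin (c x : K) : is_derive x (1 : K) (fun y => y * c) c.
Proof.
apply: is_derive_ext (is_deriveZ c (is_derive_id x (1 : K))) => [y|].
  by rewrite mulrC.
by rewrite scaler1.
Qed.

Section MatrixRules.
Context {p q : nat}.
Implicit Types f g : K -> 'M[K]_(p, q).

Lemma mx_derive_ext f g x l l' : (forall y, f y = g y) -> l = l' ->
  mx_derive f x l -> mx_derive g x l'.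
Proof. by move=> /funext -> ->. Qed.

Lemma mx_deriveD f g x a b : mx_derive f x a -> mx_derive g x b ->
  mx_derive (fun y => f y + g y) x (a + b).
Proof.
move=> fa gb i j; apply: is_derive_ext (is_deriveD (fa i j) (gb i j)) => [y|];
  by rewrite mxE.
Qed.

Lemma mx_deriveN f x a : mx_derive f x a -> mx_derive (fun y => - f y) x (- a).
Proof.
by move=> fa i j; apply: is_derive_ext (is_deriveN (fa i j)) => [y|]; rewrite mxE.
Qed.

Lemma mx_deriveB f g x a b : mx_derive f x a -> mx_derive g x b ->
  mx_derive (fun y => f y - g y) x (a - b).
Proof. by move=> fa gb; exact: mx_deriveD fa (mx_deriveN gb). Qed.

Lemma mx_derive_cst (M : 'M[K]_(p, q)) x : mx_derive (fun=> M) x 0.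
Proof.
by move=> i j; rewrite mxE; exact: (is_derive_cst (M i j) x (1 : K)).
Qed.

Lemma mx_deriveZ (h : K -> K) (x a : K) (M : 'M[K]_(p, q)) :
  is_derive x (1 : K) h a -> mx_derive (fun y => h y *: M) x (a *: M).
Proof.
move=> ha i j; apply: is_derive_ext (is_deriveZ (M i j) ha) => [y|];
  by rewrite mxE mulrC.
Qed.

Lemma mx_derive_tr f x a : mx_derive f x a -> mx_derive (fun y => (f y)^T) x a^T.
Proof.
by move=> fa i j; apply: is_derive_ext (fa j i) => [y|]; rewrite mxE.
Qed.

End MatrixRules.

(* Only the half-line to the right of -1 is used; integrating from -1 makes 0 an interior point. *)
Lemma primitive_exists (f : K -> K) : continuous f ->
  exists2 F : K -> K, F 0 = 0 & forall x : K, -1 < x -> is_derive x (1 : K) F (f x).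
Proof.
move=> fc.
pose I x := (\int[lebesgue_measure]_(t in [set` `[(-1 : K), x]]) f t)%R.
have Ider (x : K) : -1 < x -> is_derive x (1 : K) I (f x).
  move=> x1.
  have xx : x < x + 1 by rewrite ltrDl.
  have fi : (@lebesgue_measure K).-integrable `[(-1 : K), x + 1] (EFin \o f).
    apply: continuous_compact_integrable; first exact: segment_compact.
    exact: continuous_subspaceT.
  have [dI I'] := @continuous_FTC1_closed K f (-1) x (x + 1) xx fi x1 (fc x).
  by apply: DeriveDef; [exact: dI|rewrite -derive1E; exact: I'].
exists (fun x => I x - I 0) => [|x x1]; first by rewrite subrr.
have := is_deriveB (Ider x x1) (is_derive_cst (I 0) x (1 : K)).
by rewrite subr0.
Qed.

Lemma mx_primitive_exists p q (f : K -> 'M[K]_(p, q)) : continuous f ->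
  exists2 F : K -> 'M[K]_(p, q), F 0 = 0 &
    forall x : K, -1 < x -> mx_derive F x (f x).
Proof.
move=> fc.
have /choice[F FP] : forall ij : 'I_p * 'I_q, exists F : K -> K, F 0 = 0 /\
    forall x : K, -1 < x -> is_derive x (1 : K) F (f x ij.1 ij.2).
  move=> [i j].
  have [|F F0 dF] := @primitive_exists (fun x => f x i j); last by exists F.
  by move=> x; apply: cvg_entry; exact: fc.
exists (fun x => \matrix_(i, j) F (i, j) x).
  by apply/matrixP => i j; rewrite !mxE (FP (i, j)).1.
move=> x x1 i j; rewrite [X in is_derive _ _ X](_ : _ = F (i, j)).
  exact: (FP (i, j)).2.
by apply/funext => y; rewrite mxE.
Qed.

(** Joint continuity splits into continuity in [s] of one fixed primitive, and closeness of the
    primitives for nearby [t]. For the latter, compactness of [[0, T]] makes the integrands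
    uniformly close, and the mean value inequality integrates this. *)
Lemma parametric_primitive p q (T : K) (f : K -> K -> 'M[K]_(p, q)) : 0 < T ->
  continuous (fun x : K * K => f x.1 x.2) ->
  exists Y : K -> K -> 'M[K]_(p, q),
    [/\ forall t, Y t 0 = 0,
        forall t x, -1 < x -> mx_derive (Y t) x (f t x) &
        continuous (fun x : K * K => Y x.1 (clamp 0 T x.2))].
Proof.
move=> T0 fc.
have ftc t : continuous (f t).
  move=> x; apply: (@continuous_comp _ _ _ (pair t) (fun x : K * K => f x.1 x.2)).
    move=> P [[U V] [/= Ut Vx] UV]; apply: filterS Vx => y Vy; apply: UV.
    by split => //=; exact: nbhs_singleton.
  exact: fc.
have /choice[Y YP] : forall t, exists Y : K -> 'M[K]_(p, q), Y 0 = 0 /\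
    forall x : K, -1 < x -> mx_derive Y x (f t x).
  by move=> t; have [F F0 dF] := mx_primitive_exists (ftc t); exists F.
have cl s : 0 <= clamp 0 T s <= T by apply: clampP; rewrite ltW.
exists Y; split=> [t|t|[t0 s0]]; [exact: (YP t).1|exact: (YP t).2|].
apply/cvgrPdist_le => e e0 /=.
(* An error [d] in the integrand costs at most [T * d = e / 2] in the primitive. *)
pose d := e / (2 * T).
have d0 : 0 < d by rewrite divr_gt0// mulr_gt0.
have tube : \forall t \near t0, `[0, T] `<=` (fun r => `|f t r - f t0 r| <= d).
  have := (compact_near_coveringP _).1 (@segment_compact K 0 T).
  move=> /(_ K (nbhs t0) (fun t r => `|f t r - f t0 r| <= d) _); apply => r _.
  have h1 : \forall x \near (t0, r), `|f t0 r - f x.1 x.2| <= d / 2.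
    by apply: ((cvgrPdist_le _ _).1 (fc (t0, r))); rewrite divr_gt0.
  have h2 : \forall s \near r, `|f t0 r - f t0 s| <= d / 2.
    by apply: ((cvgrPdist_le _ _).1 (ftc t0 r)); rewrite divr_gt0.
  case: h1 => -[U V] /= [Ut Vr] UV.
  exists (V `&` [set s | `|f t0 r - f t0 s| <= d / 2], U) => /=.
    by split => //; exact: filterI.
  move=> [s t] /= [[Vs h2s] Ut']; rewrite -(subrKA (f t0 r)).
  rewrite (le_trans (ler_normD _ _))// [leRHS]splitr lerD// distrC.
  exact: (UV (t, s)).
have Yc : {for s0, continuous (fun s => Y t0 (clamp 0 T s))}.
  apply: (@continuous_comp _ _ _ (clamp 0 T) (Y t0)); first exact: clamp_continuous.
  apply: (@mx_derive_continuous _ _ _ _ _ (f t0 (clamp 0 T s0))).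
  apply: (YP t0).2; have /andP[h _] := cl s0; exact: lt_le_trans h.
have nY : \forall s \near s0,
    `|Y t0 (clamp 0 T s0) - Y t0 (clamp 0 T s)| <= e / 2.
  by apply: ((cvgrPdist_le _ _).1 Yc); rewrite divr_gt0.
exists ([set t | `[0, T] `<=` (fun r => `|f t r - f t0 r| <= d)],
  [set s | `|Y t0 (clamp 0 T s0) - Y t0 (clamp 0 T s)| <= e / 2]) => //=.
move=> [t s] /= [ht hs]; rewrite -(subrKA (Y t0 (clamp 0 T s))).
rewrite (le_trans (ler_normD _ _))// [leRHS]splitr lerD// distrC.
have /andP[c0 cT] := cl s; set c := clamp 0 T s in c0 cT *.
have der u x : x \in `[0, T] -> mx_derive (Y u) x (f u x).
  rewrite in_itv/= => /andP[x0 _]; apply: (YP u).2; exact: lt_le_trans x0.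
have sub x : x \in `]0, c[ -> x \in `[0, T].
  by rewrite !in_itv/= => /andP[x0 xc]; rewrite ltW//= (le_trans (ltW xc)).
have := @mx_mvt_le K p q (fun x => Y t x - Y t0 x) (fun x => f t x - f t0 x)
  (fun x => x * d) (fun=> d) 0 c c0.
rewrite (YP t).1 (YP t0).1 !subrr subr0 mul0r subr0 => h.
apply: le_trans (h _ _ _ _ _) _.
- apply: continuous_in_subspaceT => x; rewrite inE/= in_itv/= => /andP[x0 xc].
  have xT : x \in `[0, T] by rewrite in_itv/= x0 (le_trans xc).
  apply: cvgB; exact: mx_derive_continuous (der _ _ xT).
- by apply: continuous_subspaceT => x; apply: cvgM; [exact: cvg_id|exact: cvg_cst].
- by move=> x /sub xT; exact: mx_deriveB (der t x xT) (der t0 x xT).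
- by move=> x _; exact: is_derive_lin.
- by move=> x /sub xT; apply: ht.
- rewrite /d mulrA ler_pdivrMr ?mulr_gt0// [leRHS](_ : _ = e * T).
    by rewrite mulrC ler_wpM2l// ltW.
  by field.
Qed.

End Primitives.

(** * Gronwall's inequality *)

Section Tools.
Context {K : realType}.

Lemma compact_norm_bound (U : topologicalType) p q (D : set U)
    (f : U -> 'M[K]_(p, q)) : compact D -> {within D, continuous f} ->
  exists2 L : K, 0 <= L & forall x, D x -> `|f x| <= L.
Proof.
move=> cD fc; have /compact_bounded[M [_ h]] := continuous_compact fc cD.
exists (`|M| + 1) => [|x Dx]; first by rewrite addr_ge0.
by apply: h; [rewrite (le_lt_trans (ler_norm _))// ltrDl|exists x].
Qed.

Lemma continuous_within_comp (U V W : topologicalType) (D : set V)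
    (f : V -> W) (g : U -> V) : {within D, continuous f} -> continuous g ->
  (forall x, D (g x)) -> continuous (fun x => f (g x)).
Proof.
move=> /subspace_continuousP fc gc Dg x.
apply: (@cvg_comp _ _ _ g f _ _ _ _ (fc (g x) (Dg x))) => P gP.
have {}gP : nbhs x (fun y => D (g y) -> P (g y)) by exact: gc x _ gP.
by apply: filterS gP => y /(_ (Dg y)).
Qed.

Lemma continuous_pair (U V W : topologicalType) (f : U -> V) (g : U -> W) x :
  {for x, continuous f} -> {for x, continuous g} ->
  {for x, continuous (fun y => (f y, g y))}.
Proof.
move=> fc gc P [[A B] [/= Af Bg] AB].
have h : nbhs x (fun y => A (f y) /\ B (g y)).
  by apply: filterI; [exact: (fc A Af)|exact: (gc B Bg)].
by apply: filterS h => y [Ay By]; apply: AB.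
Qed.

(** Continuous induction: [S] holds at the supremum of the good initial segments because it passes
    to limits from the left, and the step leads beyond the supremum unless it is already [T]. *)
Lemma real_induction (T : K) (S : K -> Prop) : S 0 ->
  (forall s, 0 <= s < T -> S s ->
    exists2 e : K, 0 < e & forall h, 0 <= h <= e -> S (s + h)) ->
  (forall s, 0 < s <= T -> (forall r, 0 <= r < s -> S r) -> S s) ->
  forall s, 0 <= s <= T -> S s.
Proof.
move=> S0 step clos s /andP[s0 sT].
have T0 := le_trans s0 sT.
pose A := [set s | 0 <= s <= T /\ forall r, 0 <= r <= s -> S r].
have A0 : A 0.
  split=> [|r]; first by rewrite lexx.
  by move=> r0; have -> : r = 0 by apply/eqP; rewrite eq_le andbC.
have hA : has_sup A.
  by split; [exists 0|exists T => x [/andP[]]].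
have m0 : 0 <= sup A by exact: (sup_upper_bound hA).
have mT : sup A <= T by apply: ge_sup; [exists 0|move=> x [/andP[]]].
have below r : 0 <= r < sup A -> S r.
  move=> /andP[r0 rm]; have [x [_ xA] rx] := sup_adherent (eps := sup A - r)
    (etrans (subr_gt0 _ _) rm) hA.
  apply: xA; rewrite r0 ltW//; move: rx; rewrite opprB addrC subrK//.
have Sm : S (sup A).
  move: m0; rewrite le_eqVlt => /predU1P[<-//|m0].
  by apply: clos => //; rewrite m0.
have [mltT|Tm] := ltP (sup A) T; last first.
  have [sm|ms] := ltP s (sup A); first by apply: below; rewrite s0.
  have -> // : s = sup A.
  by apply/eqP; rewrite eq_le ms andbT (le_trans sT).
have [|e e0 he] := step (sup A) _ Sm; first by rewrite m0.
pose d := Num.min e (T - sup A).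
have d0 : 0 < d by rewrite lt_min e0 subr_gt0.
have : A (sup A + d).
  split=> [|r /andP[r0 rd]].
    rewrite addr_ge0 ?(ltW d0)//= -lerBrDl ge_min lexx orbT//.
  have [rm|mr] := ltP r (sup A); first by apply: below; rewrite r0.
  rewrite -(subrK (sup A) r) addrC; apply: he.
  by rewrite subr_ge0 mr/= (le_trans (y := d)) ?ge_min ?lexx// lerBlDl.
by move=> /(sup_upper_bound hA); rewrite gerDl leNgt d0.
Qed.

Lemma ge0_left_closed (f : K -> K) (s : K) : 0 < s -> {for s, continuous f} ->
  (forall r, 0 <= r < s -> 0 <= f r) -> 0 <= f s.
Proof.
move=> s0 fc f0; rewrite leNgt; apply/negP => fs.
have : \forall r \near s, f r < 0 by exact: cvgr_lt fc 0 fs.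
move=> /nbhs_ballP[e /= e0 he].
pose d := Num.min (e / 2) s.
have d0 : 0 < d by rewrite lt_min s0 divr_gt0.
have ds : d <= s by rewrite ge_min lexx orbT.
have de : d <= e / 2 by rewrite ge_min lexx.
have := f0 (s - d); rewrite subr_ge0 ds gtrBl d0 => /(_ isT).
rewrite leNgt he//= /ball/= opprB addrC subrK gtr0_norm//.
by clear -de e0; lra.
Qed.

Lemma expRM_ge1 (c x : K) : 0 <= c -> 0 <= x -> 1 <= expR (c * x).
Proof. by move=> c0 x0; rewrite -expR0 ler_expR mulr_ge0. Qed.

(** A crude bound from compactness is improved repeatedly. The rate [2 * a], twice the sharp one, is
    what makes each integration halve the excess over [k]; [b <= a * k] lets the inhomogeneous term
    be absorbed. *)
Lemma gronwall p q (f f' : K -> 'M[K]_(p, q)) (T a b k : K) :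
  0 <= T -> 0 < a -> 0 <= k -> b <= a * k ->
  (forall x, 0 <= x <= T -> mx_derive f x (f' x)) ->
  (forall x, 0 <= x <= T -> `|f' x| <= a * `|f x| + b) ->
  `|f 0| <= k -> forall x, 0 <= x <= T -> `|f x| <= k * expR (2 * a * x).
Proof.
move=> T0 a0 k0 bak df f'le f0 x0 x0T.
have fc : {within `[0, T], continuous f}.
  apply: continuous_in_subspaceT => x; rewrite inE/= in_itv/= => xT.
  exact: mx_derive_continuous (df x xT).
have [W W0 fW] := compact_norm_bound (@segment_compact _ 0 T) fc.
have main j : forall x, 0 <= x <= T ->
    `|f x| <= (k + W / 2 ^+ j) * expR (2 * a * x).
  elim: j => [|j IH] x xT; have /andP[xge0 xleT] := xT.
    rewrite expr0 divr1 (@le_trans _ _ (k + W))//.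
      by rewrite (le_trans (fW x _)) ?lerDr//= in_itv.
    by rewrite ler_peMr ?addr_ge0// expRM_ge1// mulr_ge0// ltW.
  have E0 : (0 : K) < 2 ^+ j by rewrite exprn_gt0.
  set w := W / 2 ^+ j.+1.
  have wE : W / 2 ^+ j = w + w by rewrite /w exprS; field; rewrite gt_eqF.
  have w0 : 0 <= w by rewrite /w divr_ge0// exprn_ge0.
  have := @mx_mvt_le K p q f f' (fun x => (k + w) * expR (2 * a * x))
    (fun x => 2 * a * ((k + w) * expR (2 * a * x))) 0 x xge0.
  rewrite mulr0 expR0 mulr1 => h.
  rewrite -(subrK (f 0) (f x)) (le_trans (ler_normD _ _))//.
  have {}h : `|f x - f 0| <= (k + w) * expR (2 * a * x) - (k + w).
    apply: h => //.
    - apply: continuous_subspaceW fc => y /=; rewrite !in_itv/= => /andP[-> yx].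
      exact: le_trans xleT.
    - apply: continuous_in_subspaceT => y _.
      have := is_derive_exp (k + w) (2 * a) y => dy.
      have /derivable1_diffP/differentiable_continuous hc := @ex_derive _ _ _ _ _ _ _ dy.
      exact: hc.
    - move=> y; rewrite in_itv/= => /andP[y0 yx]; apply: df.
      by rewrite ltW//= (le_trans (ltW yx)).
    - by move=> y _; exact: is_derive_exp.
    - move=> y; rewrite in_itv/= => /andP[y0 yx].
      have yT : 0 <= y <= T by rewrite ltW//= (le_trans (ltW yx)).
      have e1 : 1 <= expR (2 * a * y) by rewrite expRM_ge1 ?mulr_ge0// ltW.
      rewrite (le_trans (f'le y yT))//.
      rewrite (@le_trans _ _ (a * ((k + (w + w)) * expR (2 * a * y)) + b))//.
        by rewrite lerD2r ler_pM2l// -wE IH.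
      (* The terms in [w] cancel exactly: the excess [w + w] at rate [a] equals [w] at rate
         [2 * a]. *)
      rewrite -subr_ge0 (_ : _ - _ = a * k * (expR (2 * a * y) - 1) + (a * k - b)).
        by rewrite addr_ge0 ?subr_ge0// mulr_ge0 ?subr_ge0// mulr_ge0// ltW.
      by ring.
  by rewrite (le_trans (lerD h f0))// -addrA gerDl opprD addrAC addNr add0r oppr_le0.
apply: (@le_geometric_slack _ _ _ (W * expR (2 * a * x0))) => j.
by apply: le_trans (main j x0 x0T) _; rewrite mulrDl lerD2l mulrAC.
Qed.

End Tools.

(** * Picard iteration *)

Section Picard.
Context {K : realType} {p q : nat}.
Local Notation V := 'M[K]_(p, q).
Local Notation W := (V * V)%type.

Lemma prod_norm_le (x y : W) (a : K) :
  `|x.1 - y.1| <= a -> `|x.2 - y.2| <= a -> `|x - y| <= a.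
Proof. by move=> h1 h2; rewrite prod_normE /= ge_max h1 h2. Qed.

(** The second argument of [F] carries the nonlocal value [X (T - s) s], which is the diagonal in
    reversed time. Differentiating the weight [expR (2 * L * s)] produces [2 * L], so one
    integration contracts by 1/2. The parameter [t] ranges over all of [K]; uniformity in it comes
    from the global bound on [F]. *)
Lemma picard (F : K * K -> W -> V) (G : K -> V) (T : K) :
  0 < T -> continuous G -> bounded_lipschitz_mx F ->
  exists X : K -> K -> V,
    [/\ continuous (fun z : K * K => X z.1 (clamp 0 T z.2)),
        forall t, X t 0 = G t &
        forall t s, 0 <= s <= T ->
          mx_derive (X t) s (F (t, s) (X t s, X (T - s) s))].
Proof.
move=> T0 Gc /BLM_norm[Fc [B B0 FB] [L L0 FL]].
have cl s : 0 <= clamp 0 T s <= T by apply: clampP; rewrite ltW.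
(* Choice needs a total map, so the continuity of [U] is a premise of the specification and other
   [U] get a dummy value. *)
have /choice[N NP] : forall U : K * K -> V, exists Y : K -> K -> V,
    continuous U ->
    [/\ continuous (fun z : K * K => Y z.1 (clamp 0 T z.2)),
        forall t, Y t 0 = G t &
        forall t s, 0 <= s <= T ->
          mx_derive (Y t) s (F (t, s) (U (t, s), U (T - s, s)))].
  move=> U; have [Uc|nUc] := pselect (continuous U); last by exists (fun _ _ => 0).
  pose f t r := F (t, r) (U (t, r), U (T - r, r)).
  have fc : continuous (fun z : K * K => f z.1 z.2).
    rewrite (_ : (fun z : K * K => f z.1 z.2) = fun z => F z (U z, U (T - z.2, z.2)));
      last by apply/funext => -[].
    move=> z; apply: (@continuous_comp _ _ _
      (fun z : K * K => (z, (U z, U (T - z.2, z.2)))) (fun z => F z.1 z.2)); last exact: Fc.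
    apply: continuous_pair; first exact: cvg_id.
    apply: continuous_pair; first exact: Uc.
    apply: (@continuous_comp _ _ _ (fun z : K * K => (T - z.2, z.2)) U); last exact: Uc.
    apply: continuous_pair; last exact: cvg_snd.
    by apply: cvgB; [exact: cvg_cst|exact: cvg_snd].
  have [Y [Y0 dY Yc]] := parametric_primitive T0 fc.
  exists (fun t s => G t + Y t s) => _; split.
  - move=> z; apply: cvgD; last exact: Yc.
    by apply: (@continuous_comp _ _ _ fst G); [exact: cvg_fst|exact: Gc].
  - by move=> t; rewrite Y0 addr0.
  - move=> t s /andP[s0 _].
    apply: mx_derive_ext (mx_deriveD (mx_derive_cst (G t) s) (dY t s _)) => //.
      by rewrite add0r.
    exact: lt_le_trans s0.
pose next U := fun z : K * K => N U z.1 (clamp 0 T z.2).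
have nextc U : continuous U -> continuous (next U).
  by move=> /NP[].
have nextE U t s : 0 <= s <= T -> next U (t, s) = N U t s.
  by move=> sT; rewrite /next/= clamp_id.
have contr U1 U2 (a : K) : continuous U1 -> continuous U2 ->
    (forall t s, 0 <= s <= T ->
      `|U1 (t, s) - U2 (t, s)| <= a * expR (2 * L * s)) ->
    forall t s, 0 <= s <= T ->
      `|next U1 (t, s) - next U2 (t, s)| <= a / 2 * expR (2 * L * s).
  move=> c1 c2 U12 t s sT; rewrite !nextE//; have /andP[s0 sleT] := sT.
  have [_ N10 dN1] := NP _ c1; have [_ N20 dN2] := NP _ c2.
  have a0 : 0 <= a.
    have := U12 0 0; rewrite lexx ltW// => /(_ isT) /(le_trans (normr_ge0 _)).
    by rewrite mulr0 expR0 mulr1.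
  pose f' x := F (t, x) (U1 (t, x), U1 (T - x, x)) -
               F (t, x) (U2 (t, x), U2 (T - x, x)).
  have dD x : 0 <= x <= T -> mx_derive (fun x => N U1 t x - N U2 t x) x (f' x).
    by move=> xT; exact: mx_deriveB (dN1 t x xT) (dN2 t x xT).
  have inT x : x \in `]0, s[ -> 0 <= x <= T.
    by rewrite in_itv/= => /andP[x0 xs]; rewrite ltW//= (le_trans (ltW xs)).
  have := @mx_mvt_le K p q _ f' (fun x => a / 2 * expR (2 * L * x))
    (fun x => 2 * L * (a / 2 * expR (2 * L * x))) 0 s s0 _ _
    (fun x xs => dD x (inT x xs)) (fun x _ => is_derive_exp (a / 2) (2 * L) x).
  rewrite N10 N20 subrr subr0 mulr0 expR0 mulr1 => h.
  rewrite (le_trans (h _ _ _))//; last by rewrite gerDl oppr_le0 divr_ge0.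
  - apply: continuous_in_subspaceT => x; rewrite inE/= in_itv/= => /andP[x0 xs].
    by apply: mx_derive_continuous (dD x _); rewrite x0 (le_trans xs).
  - apply: continuous_in_subspaceT => y _.
    have := is_derive_exp (a / 2) (2 * L) y => dy.
    have /derivable1_diffP/differentiable_continuous hc := @ex_derive _ _ _ _ _ _ _ dy.
    exact: hc.
  - move=> x /inT xT; rewrite (le_trans (FL _ _ _))//.
    rewrite (_ : 2 * L * _ = L * (a * expR (2 * L * x))); last by field.
    rewrite ler_pM2l//; apply: prod_norm_le => /=; apply: U12 => //.
pose u k := iter k next (fun z => G z.1).
have uc k : continuous (u k).
  elim: k => [|k IH] /=; last exact: nextc.
  by move=> z; apply: (@continuous_comp _ _ _ fst G); [exact: cvg_fst|exact: Gc].
have u1 t s : 0 <= s <= T -> `|u 1%N (t, s) - u 0%N (t, s)| <= B * T * expR (2 * L * s).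
  move=> sT; have /andP[s0 sleT] := sT.
  rewrite [u 1%N _]nextE//= -/(u 0%N).
  have [_ N0 dN] := NP _ (uc 0%N); rewrite -(N0 t).
  have inT x : x \in `]0, s[ -> 0 <= x <= T.
    by rewrite in_itv/= => /andP[x0 xs]; rewrite ltW//= (le_trans (ltW xs)).
  have := @mx_mvt_le K p q (N (u 0%N) t) _ (fun x => x * B) (fun=> B) 0 s s0 _ _
    (fun x xs => dN t x (inT x xs)) (fun x _ => is_derive_lin B x).
  rewrite mul0r subr0 => h; rewrite (le_trans (h _ _ _))//.
  - apply: continuous_in_subspaceT => x; rewrite inE/= in_itv/= => /andP[x0 xs].
    by apply: mx_derive_continuous (dN t x _); rewrite x0 (le_trans xs).
  - by apply: continuous_subspaceT => x; apply: cvgM; [exact: cvg_id|exact: cvg_cst].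
  - rewrite mulrC; apply: (@le_trans _ _ (B * T)); first by rewrite ler_pM2l.
    by rewrite ler_peMr ?expRM_ge1 ?mulr_ge0// ltW.
have uk k t s : 0 <= s <= T ->
    `|u k.+1 (t, s) - u k (t, s)| <= B * T / 2 ^+ k * expR (2 * L * s).
  elim: k t s => [|k IH] t s sT; first by rewrite expr0 divr1 u1.
  rewrite exprSr invfM mulrA; exact: (contr _ _ _ (uc k.+1) (uc k) IH).
(* Iterates depend on the second coordinate only through its clamp, so estimates on [[0, T]] hold on
   the whole plane. *)
have ucl k z : u k z = u k (z.1, clamp 0 T z.2).
  by case: k => //= k; rewrite /next/= [clamp 0 T (clamp _ _ _)]clamp_id.
(* The weight is largest at [T], which turns the weighted differences into uniform ones. *)
pose C := B * T * expR (2 * L * T).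
have [v vc vu] : exists2 v : K * K -> V, continuous v &
    forall k x, `|v x - u k x| <= 2 * C / 2 ^+ k.
  apply: geometric_uniform_limit => // k z; rewrite ucl [u k z]ucl.
  rewrite (le_trans (uk _ _ _ (cl _)))// /C mulrAC ler_pM2r ?invr_gt0 ?exprn_gt0//.
  rewrite ler_pM2l ?mulr_gt0// ler_expR ler_pM2l ?mulr_gt0//.
  by have /andP[] := cl z.2.
have C0 : 0 <= C by rewrite !mulr_ge0 ?expR_ge0// ltW.
(* Both sides are compared with [u k.+1]: the contraction controls one distance and the uniform
   limit the other, each of order 1 / 2^k. *)
have fixv t s : 0 <= s <= T -> N v t s = v (t, s).
  move=> sT; apply/eqP; rewrite -subr_eq0 -normr_le0.
  apply: (@le_geometric_slack _ _ _ (C * expR (2 * L * s) + C)) => k.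
  rewrite add0r -(nextE v)// -(subrKA (u k.+1 (t, s))) (le_trans (ler_normD _ _))//.
  rewrite [leRHS]mulrDl lerD//.
    have -> : C * expR (2 * L * s) / 2 ^+ k = (2 * C / 2 ^+ k) / 2 * expR (2 * L * s).
      by field; rewrite expf_neq0 ?pnatr_eq0.
    apply: (contr _ _ _ vc (uc k)) => // t' s' /andP[s'0 _].
    rewrite (le_trans (vu _ _))// ler_peMr ?expRM_ge1 ?mulr_ge0 ?invr_ge0 ?exprn_ge0// ltW//.
  rewrite distrC (le_trans (vu _ _))// exprS invfM mulrACA divff ?pnatr_eq0// mul1r//.
have [Nc N0 dN] := NP _ vc.
exists (N v); split=> // t s sT.
by rewrite !fixv//; exact: dN.
Qed.

End Picard.

(** * Quadratic forms *)

Section QuadraticForms.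
Context {K : realType}.

Definition qf n (M : 'M[K]_n) (x : 'cV[K]_n) : K := (x^T *m M *m x) 0 0.

Definition sqn n (x : 'cV[K]_n) : K := (x^T *m x) 0 0.

Lemma qfE n (M : 'M[K]_n) x : qf M x = \sum_j \sum_i x i 0 * M i j * x j 0.
Proof.
rewrite /qf mxE; apply: eq_bigr => j _; rewrite !mxE mulr_suml.
by apply: eq_bigr => i _; rewrite mxE.
Qed.

Lemma sqnE n (x : 'cV[K]_n) : sqn x = \sum_i x i 0 ^+ 2.
Proof. by rewrite /sqn mxE; apply: eq_bigr => i _; rewrite mxE. Qed.

Lemma sqn_ge0 n (x : 'cV[K]_n) : 0 <= sqn x.
Proof. by rewrite sqnE sumr_ge0// => i _; exact: sqr_ge0. Qed.

Lemma sqn_eq0 n (x : 'cV[K]_n) : sqn x <= 0 -> x = 0.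
Proof.
move=> h; have /eqP : sqn x = 0 by apply/eqP; rewrite eq_le h sqn_ge0.
rewrite sqnE psumr_eq0 => [/allP h0|i _]; last exact: sqr_ge0.
apply/matrixP => i j; rewrite (ord1 j) mxE; apply/eqP.
by have := h0 i (mem_index_enum i); rewrite sqrf_eq0.
Qed.

Lemma qfD n (M N : 'M[K]_n) x : qf (M + N) x = qf M x + qf N x.
Proof. by rewrite /qf mulmxDr mulmxDl mxE. Qed.

Lemma qfN n (M : 'M[K]_n) x : qf (- M) x = - qf M x.
Proof. by rewrite /qf mulmxN mulNmx mxE. Qed.

Lemma qfZ n a (M : 'M[K]_n) x : qf (a *: M) x = a * qf M x.
Proof. by rewrite /qf -scalemxAr -scalemxAl mxE. Qed.

Lemma qf_scalar n a (x : 'cV[K]_n) : qf a%:M x = a * sqn x.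
Proof. by rewrite /qf mul_mx_scalar -scalemxAl mxE. Qed.

Lemma qf_congr n m (M : 'M[K]_n) (N : 'M[K]_(n, m)) x :
  qf (N^T *m M *m N) x = qf M (N *m x).
Proof. by rewrite /qf trmx_mul !mulmxA. Qed.

(** Each product of coordinates is at most half the sum of their squares; every square then occurs
    [n] times in the double sum. *)
Lemma qf_bound n (M : 'M[K]_n) x : `|qf M x| <= n%:R * `|M| * sqn x.
Proof.
rewrite qfE (le_trans (ler_norm_sum _ _ _))//.
apply: (@le_trans _ _ (\sum_(j < n) \sum_(i < n)
    (`|M| / 2 * x i 0 ^+ 2 + `|M| / 2 * x j 0 ^+ 2))).
  apply: ler_sum => j _; rewrite (le_trans (ler_norm_sum _ _ _))//.
  apply: ler_sum => i _; rewrite !normrM.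
  apply: (@le_trans _ _ (`|M| * (`|x i 0| * `|x j 0|))).
    by rewrite mulrAC mulrC ler_wpM2r ?mulr_ge0// mx_norm_entry.
  rewrite -mulrDr -mulrA ler_wpM2l// -!(real_normK (num_real (x _ _))).
  have := sqr_ge0 (`|x i 0| - `|x j 0|).
  by rewrite sqrrB; lra.
rewrite (eq_bigr (fun j => `|M| / 2 * sqn x + n%:R * (`|M| / 2 * x j 0 ^+ 2))).
  rewrite big_split/= sumr_const card_ord -mulr_sumr -mulr_sumr -sqnE -mulr_natl.
  by rewrite le_eqVlt; apply/orP; left; apply/eqP; field.
move=> j _; rewrite big_split/= -mulr_sumr -sqnE sumr_const card_ord.
by rewrite mulr_natl.
Qed.

Lemma qf_ge n (M : 'M[K]_n) x : - (n%:R * `|M| * sqn x) <= qf M x.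
Proof. by have := qf_bound M x; rewrite ler_norml => /andP[]. Qed.

Lemma qf_le n (M : 'M[K]_n) x : qf M x <= n%:R * `|M| * sqn x.
Proof. by have := qf_bound M x; rewrite ler_norml => /andP[]. Qed.

Lemma SymD n (M N : 'M[K]_n) : Sym M -> Sym N -> Sym (M + N).
Proof. by move=> h1 h2; rewrite /Sym/= linearD/= h1 h2. Qed.

Lemma Sym_scalar n a : Sym (a%:M : 'M[K]_n).
Proof. by rewrite /Sym/= tr_scalar_mx. Qed.

Lemma Sym_congr n m (M : 'M[K]_n) (N : 'M[K]_(n, m)) :
  Sym M -> Sym (N^T *m M *m N).
Proof. by move=> h; rewrite /Sym/= !trmx_mul trmxK h mulmxA. Qed.

Lemma SymPosD n (M N : 'M[K]_n) : SymPos M -> SymPos N -> SymPos (M + N).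
Proof.
move=> [sM pM] [sN pN]; split=> [|x]; first exact: SymD.
by rewrite -/(qf _ _) qfD addr_ge0// ?pM ?pN.
Qed.

Lemma SymPos_congr n m (M : 'M[K]_n) (N : 'M[K]_(n, m)) :
  SymPos M -> SymPos (N^T *m M *m N).
Proof.
move=> [sM pM]; split=> [|x]; first exact: Sym_congr.
by rewrite -/(qf _ _) qf_congr; exact: pM.
Qed.

Lemma SymPos_scalar n a : 0 <= a -> SymPos (a%:M : 'M[K]_n).
Proof.
move=> a0; split=> [|x]; first exact: Sym_scalar.
by rewrite -/(qf _ _) qf_scalar mulr_ge0// sqn_ge0.
Qed.

(* Testing the form on [e_i + e_j] and [e_i - e_j] bounds an entry by the diagonal. *)
Lemma SymPos_norm_le n (M : 'M[K]_n) u : 0 <= u -> SymPos M ->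
  (forall x, qf M x <= u * sqn x) -> `|M| <= u.
Proof.
move=> u0 [sM pM] Mu; apply: mx_norm_le => // i j.
pose e k : 'cV[K]_n := delta_mx k 0.
have qfe k l : (e k)^T *m M *m e l = (M k l)%:M.
  rewrite /e trmx_delta -rowE; apply/matrixP => a b; rewrite (ord1 a) (ord1 b).
  by rewrite -colE !mxE eqxx.
have Mkk k : M k k <= u.
  have := Mu (e k); rewrite /qf qfe mxE eqxx mulr1n.
  by rewrite /sqn trmx_delta mul_delta_mx mxE !eqxx mulr1.
have Mji : M j i = M i j by rewrite -[in LHS]sM mxE.
have hp := pM (e i + e j); have hm := pM (e i - e j).
rewrite [(_ + _)^T]linearD/= !mulmxDr !mulmxDl !qfe !mxE !eqxx !mulr1n in hp.
rewrite [(_ - _)^T]linearB/= !mulmxBr !mulmxBl !qfe in hm.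
rewrite !mxE !eqxx !mulr1n in hm.
have := Mkk i; have := Mkk j; rewrite ler_norml.
by move=> ? ?; apply/andP; split; lra.
Qed.

End QuadraticForms.

(** * Positivity of Lyapunov equations *)

Section LyapunovPositivity.
Context {K : realType}.

Lemma is_derive_quotient (f : K -> K) (x l : K) : is_derive x (1 : K) f l ->
  h^-1 * (f (x + h) - f x) @[h --> (0 : K)^'] --> l.
Proof.
move=> fl; have := @ex_derive _ _ _ _ _ _ _ fl.
have <- := @derive_val _ _ _ _ _ _ _ fl.
rewrite /derivable /derive => /cvgP h.
rewrite [X in X @ _ --> _](_ : _ = fun h => h^-1 *: (f (h *: (1 : K) + x) - f x)) //.
by apply/funext => r; rewrite /GRing.scale/= mulr1 [r + x]addrC.
Qed.

Lemma mx_derive_quotient p q (f : K -> 'M[K]_(p, q)) (x : K) l :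
  mx_derive f x l -> h^-1 *: (f (x + h) - f x) @[h --> (0 : K)^'] --> l.
Proof.
move=> fl; apply: cvg_mx_entries => i j.
rewrite [X in X @ _ --> _](_ : _ = fun h => h^-1 * (f (x + h) i j - f x i j)).
  exact: (is_derive_quotient (fl i j)).
by apply/funext => h; rewrite !mxE.
Qed.

Lemma mx_derive_expansion p q (f : K -> 'M[K]_(p, q)) (x e : K) l :
  mx_derive f x l -> 0 < e ->
  exists2 d : K, 0 < d & forall h, 0 <= h <= d ->
    `|f (x + h) - f x - h *: l| <= h * e.
Proof.
move=> fl e0.
have := (cvgrPdist_le _ _).1 (mx_derive_quotient fl) e e0.
rewrite near_withinE => -[/= d d0 dP].
exists (d / 2) => [|h /andP[h0 hd]]; first by rewrite divr_gt0.
move: h0; rewrite le_eqVlt => /predU1P[<-|h0].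
  by rewrite addr0 subrr scale0r subrr normr0 mul0r.
have := dP h; rewrite /= sub0r normrN gtr0_norm// => /(_ _ _).
have hd' : h < d by rewrite (le_lt_trans hd)// ltr_pdivrMr// ltr_pMr// ltr1n.
move=> /(_ hd'); rewrite gt_eqF// => /(_ isT) hl.
rewrite (_ : _ - _ - _ = (- h) *: (l - h^-1 *: (f (x + h) - f x))).
  by rewrite normrZ normrN gtr0_norm// ler_pM2l.
rewrite scalerBr scalerA mulNr divff ?gt_eqF// scaleN1r opprK scaleNr addrC.
by [].
Qed.

Lemma continuous_qf n (Z : K -> 'M[K]_n) s x : {for s, continuous Z} ->
  {for s, continuous (fun r => qf (Z r) x)}.
Proof.
move=> Zc; apply/cvgrPdist_le => e e0.
pose c := n%:R * sqn x + 1.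
have c0 : 0 < c by rewrite ltr_wpDl// mulr_ge0// sqn_ge0.
have h : \forall r \near s, `|Z s - Z r| <= e / c.
  by apply: ((cvgrPdist_le _ _).1 Zc); rewrite divr_gt0.
apply: filterS h => r; rewrite ler_pdivlMr// -qfN -qfD => h.
rewrite (le_trans (qf_bound _ _))// (le_trans _ h)// mulrAC mulrC ler_wpM2l//.
by rewrite lerDl.
Qed.

(** Up to a term of order h^2, Z + h (Z A + A^T Z) is the congruence (1 + h A)^T Z (1 + h A), which
    inherits nonnegativity even where [Z s] is singular, and C^T Z C is nonnegative as well. All
    errors are multiples of [sqn x], so one step size serves every [x]. *)
Lemma lyapunov_step n (Z : K -> 'M[K]_n) (s eta : K) (Z' A C : 'M[K]_n) :
  0 < eta -> mx_derive Z s Z' -> (forall x, 0 <= qf (Z s) x) ->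
  (forall x, qf (Z s *m A + A^T *m Z s + C^T *m Z s *m C) x + eta * sqn x <= qf Z' x) ->
  exists2 e : K, 0 < e & forall h, 0 <= h <= e -> forall x, 0 <= qf (Z (s + h)) x.
Proof.
move=> eta0 dZ Z0 ZZ'.
have n1 : 0 < n%:R + 1 :> K by rewrite ltr_wpDl.
(* Half of the margin [eta] pays for the remainder of the first-order expansion, the other half for
   the term of order h^2. *)
pose r := eta / 2 / (n%:R + 1).
have r0 : 0 < r by rewrite !divr_gt0.
have nr : n%:R * r <= eta / 2.
  rewrite /r mulrA ler_pdivrMr// [leRHS]mulrC ler_wpM2r ?lerDl//.
  by rewrite divr_ge0// ltW.
have [d d0 dP] := mx_derive_expansion dZ r0.
pose M := n%:R * `|A^T *m Z s *m A|.
have M0 : 0 <= M by rewrite mulr_ge0.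
exists (Num.min d (eta / 2 / (M + 1))) => [|h].
  by rewrite lt_min d0 !divr_gt0// ltr_wpDl.
rewrite le_min => /andP[h0 /andP[hd hM]] x.
have sx := sqn_ge0 x.
pose E := Z (s + h) - Z s - h *: Z'.
have Eb : - (h * (eta / 2) * sqn x) <= qf E x.
  apply: le_trans (qf_ge E x); rewrite lerN2 ler_wpM2r//.
  have := dP h; rewrite h0 => /(_ hd) Er.
  apply: (@le_trans _ _ (n%:R * (h * r))); first by rewrite ler_wpM2l.
  by rewrite mulrCA ler_wpM2l.
have ZE : Z (s + h) = Z s + h *: Z' + E 
  by rewrite /E; apply/matrixP => i j; rewrite !mxE; ring.
have sq : qf (Z s) x + h * qf (Z s *m A + A^T *m Z s) x + h * h * qf (A^T *m Z s *m A) x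
    = qf (Z s) (x + h *: (A *m x)).
  rewrite -[X in _ = qf _ X](_ : (1%:M + h *: A) *m x = _); last first.
    by rewrite mulmxDl mul1mx -scalemxAl.
  rewrite -qf_congr [(_ + _)^T]linearD/= [(_ *: _)^T]linearZ/= trmx1.
  rewrite mulmxDl mul1mx mulmxDr mulmx1 mulmxDl -!scalemxAr -!scalemxAl.
  rewrite !qfD !qfZ.
  by ring.
have qC : 0 <= qf (C^T *m Z s *m C) x by rewrite qf_congr.
have qA := qf_le (A^T *m Z s *m A) x; rewrite -/M in qA.
have qsq := Z0 (x + h *: (A *m x)); rewrite -sq in qsq.
have hh := ler_wpM2l h0 (ZZ' x).
rewrite ZE qfD qfD qfZ.
rewrite qfD in hh.
have hhM : h * h * qf (A^T *m Z s *m A) x <= h * (eta / 2) * sqn x.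
  apply: (@le_trans _ _ (h * h * (M * sqn x))).
    by rewrite ler_wpM2l// mulr_ge0.
  rewrite -mulrA -[leRHS]mulrA ler_wpM2l// mulrA ler_wpM2r//.
  move: hM; rewrite ler_pdivlMr ?ltr_wpDl// => hM; apply: le_trans hM.
  by rewrite ler_wpM2l// lerDl.
have hC : 0 <= h * qf (C^T *m Z s *m C) x by rewrite mulr_ge0.
rewrite mulrDr mulrDr in hh.
rewrite -subr_ge0; move: qsq hh hhM hC Eb.
set a := qf (Z s) x.
set b := h * qf (Z s *m A + A^T *m Z s) x.
set c := h * h * _; set u := h * qf (C^T *m _ *m _) x.
rewrite (_ : h * (eta * sqn x) = h * (eta / 2) * sqn x + h * (eta / 2) * sqn x); last by field.
set w := h * (eta / 2) * sqn x.
set z := h * qf Z' x; set v := qf E x.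
by clear => *; lra.
Qed.

(** The difference between [Z] and its transpose solves the homogeneous equation with initial value
    0, so Gronwall with [k = 0] forces it to vanish. *)
Lemma lyapunov_sym n (T L : K) (Z A C N : K -> 'M[K]_n) :
  0 <= T -> 0 <= L ->
  (forall s : K, 0 <= s <= T -> `|A s| <= L /\ `|C s| <= L) ->
  (forall s : K, 0 <= s <= T -> mx_derive Z s
    (Z s *m A s + (A s)^T *m Z s + (C s)^T *m Z s *m C s + N s)) ->
  (forall s : K, 0 <= s <= T -> Sym (N s)) -> Sym (Z 0) ->
  forall s : K, 0 <= s <= T -> Sym (Z s).
Proof.
move=> T0 L0 ACL dZ sN sZ0 s sT.
pose D x := Z x - (Z x)^T.
pose D' x := D x *m A x + (A x)^T *m D x + (C x)^T *m D x *m C x.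
pose a := 1 + n%:R * (2 * L + n%:R * (L * L)).
have a0 : 0 < a by rewrite ltr_pwDl// mulr_ge0// addr_ge0// ?mulr_ge0.
have dD x : 0 <= x <= T -> mx_derive D x (D' x).
  move=> xT; apply: mx_derive_ext (mx_deriveB (dZ x xT) (mx_derive_tr (dZ x xT))) => //.
  rewrite !linearD/= !trmx_mul !trmxK (sN x xT) /D' /D.
  rewrite !mulmxBl !mulmxBr !mulmxBl !mulmxA.
  set k1 := Z x *m A x; set k2 := _^T *m Z x; set k3 := _ *m _ *m C x.
  set k4 := _ *m (Z x)^T; set k5 := (Z x)^T *m A x; set k6 := _ *m _ *m C x.
  by apply/matrixP => i j; rewrite !mxE; ring.
have := @gronwall K n n D D' T a 0 0 T0 a0 (lexx _).
rewrite mulr0 => /(_ (lexx _) dD).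
have -> : D 0 = 0 by rewrite /D sZ0 subrr.
rewrite normr0 lexx => h.
have : `|D s| <= 0 * expR (2 * a * s).
  apply: h => // x xT; have [AL CL] := ACL x xT.
  rewrite addr0 /D' (le_trans (ler_normD _ _))//.
  have B1 : `|D x *m A x| <= n%:R * (`|D x| * L).
    by rewrite (le_trans (mx_norm_mul _ _))// !ler_wpM2l.
  have B2 : `|(A x)^T *m D x| <= n%:R * (`|D x| * L).
    by rewrite (le_trans (mx_norm_mul _ _))// mx_norm_tr [`|D x| * L]mulrC ler_wpM2l// ler_wpM2r.
  have B3 : `|(C x)^T *m D x *m C x| <= n%:R * (n%:R * (`|D x| * L) * L).
    rewrite (le_trans (mx_norm_mul _ _))// ler_wpM2l// ler_pM//.
    rewrite (le_trans (mx_norm_mul _ _))// mx_norm_tr.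
    by rewrite [`|D x| * L]mulrC ler_wpM2l// ler_wpM2r.
  rewrite (le_trans (lerD (le_trans (ler_normD _ _) (lerD B1 B2)) B3))//.
  rewrite /a -subr_ge0 (_ : _ - _ = `|D x|)//; ring.
rewrite mul0r normr_le0 subr_eq0 => /eqP; exact: esym.
Qed.

(** Adding [e * expR (k * s)] times the identity creates the strict margin that [lyapunov_step]
    needs: [k] exceeds by 1 a bound for the Lyapunov operator at the identity. Continuous induction
    then covers [[0, T]], and [e] tends to 0. *)
Lemma lyapunov_psd n (T L : K) (Z A C N : K -> 'M[K]_n) :
  0 <= T -> 0 <= L ->
  (forall s : K, 0 <= s <= T -> `|A s| <= L /\ `|C s| <= L) ->
  (forall s : K, 0 <= s <= T -> mx_derive Z s
    (Z s *m A s + (A s)^T *m Z s + (C s)^T *m Z s *m C s + N s)) ->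
  (forall s : K, 0 <= s <= T -> SymPos (N s)) -> SymPos (Z 0) ->
  forall s : K, 0 <= s <= T -> SymPos (Z s).
Proof.
move=> T0 L0 ACL dZ pN pZ0 s sT; split.
  by apply: (lyapunov_sym T0 L0 ACL dZ _ _ sT) => [x /pN[]//|]; exact: pZ0.1.
move=> x; rewrite -/(qf _ _).
pose k := 1 + n%:R * (2 * L + n%:R * (L * L)).
suff main (e : K) : 0 < e -> forall s : K, 0 <= s <= T ->
    forall x, 0 <= qf (Z s + (e * expR (k * s)) *: 1%:M) x.
  have [/sqn_eq0 ->|sx] := leP (sqn x) 0; first by rewrite /qf mulmx0 mxE.
  apply/ler_addgt0Pr => e e0.
  (* With this size the perturbation contributes exactly [e] to the form at [x]. *)
  have e1 : 0 < e / (expR (k * s) * sqn x) by rewrite divr_gt0// mulr_gt0// expR_gt0.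
  have := main _ e1 s sT x; rewrite qfD qfZ qf_scalar mul1r -mulrA divfK//.
  by rewrite gt_eqF// mulr_gt0// expR_gt0.
move=> e0; clear s x sT.
pose Y s := Z s + (e * expR (k * s)) *: 1%:M.
have dY s : 0 <= s <= T -> mx_derive Y s
    (Z s *m A s + (A s)^T *m Z s + (C s)^T *m Z s *m C s + N s +
     (k * (e * expR (k * s))) *: 1%:M).
  by move=> sT; apply: mx_deriveD (dZ s sT) (mx_deriveZ _ (is_derive_exp e k s)).
apply: (@real_induction K T (fun s => forall x, 0 <= qf (Y s) x)).
- move=> x; rewrite /Y qfD qfZ qf_scalar mulr0 expR0 mul1r mulr1.
  by rewrite addr_ge0//; [exact: pZ0.2|rewrite mulr_ge0 ?sqn_ge0// ltW].
- move=> s /andP[s0 sT] Ys.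
  have s0T : 0 <= s <= T by rewrite s0 ltW.
  have [AL CL] := ACL s s0T.
  have E0 : 0 < e * expR (k * s) by rewrite mulr_gt0 ?expR_gt0.
  apply: (lyapunov_step (A := A s) (C := C s) E0 (dY s s0T) Ys) => x.
  rewrite /Y; set E := e * expR (k * s) in E0 *.
  rewrite !mulmxDl !mulmxDr !mulmxDl -!scalemxAl -!scalemxAr !mul1mx !mulmx1 -scalemxAl.
  rewrite !qfD !qfZ qf_scalar mul1r.
  have hN := (pN s s0T).2 x; rewrite -/(qf _ _) in hN.
  have hb : qf (A s) x + qf (A s)^T x + qf ((C s)^T *m C s) x <= (k - 1) * sqn x.
    rewrite -!qfD (le_trans (qf_le _ _))// ler_wpM2r ?sqn_ge0//.
    rewrite /k [1 + _]addrC addrK ler_wpM2l// (le_trans (ler_normD _ _))//.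
    rewrite lerD//.
      rewrite (le_trans (ler_normD _ _))// mx_norm_tr mulr_natl mulr2n lerD//.
    by rewrite (le_trans (mx_norm_mul _ _))// mx_norm_tr ler_wpM2l// ler_pM.
  have := ler_wpM2l (ltW E0) hb; rewrite !mulrDr mulrBl mul1r mulrBr.
  rewrite (_ : k * E * sqn x = E * (k * sqn x)); last by ring.
  by lra.
- move=> s /andP[s0 sT] below x; have s0T : 0 <= s <= T by rewrite ltW.
  apply: (ge0_left_closed s0 (continuous_qf (mx_derive_continuous (dY s s0T)))).
  by move=> r rs; exact: below.
Qed.

End LyapunovPositivity.

(** * The feedback and its truncation *)

Section Feedback.
Context {K : realType}.

(** The form vanishes at a kernel vector, so coercivity makes that vector zero. If y is column j of
    the inverse, then S y is a basis vector and d |y|^2 <= y_j; hence y_j <= 1/d, and then |y|^2 <=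
    1/d^2. *)
Lemma coercive_unitmx m (d : K) (S : 'M[K]_m) : 0 < d -> d%:M <=L S ->
  S \in unitmx /\ `|invmx S| <= d^-1.
Proof.
move=> d0 [_ dS].
have co x : d * sqn x <= qf S x.
  by have := dS x; rewrite -/(qf _ _) qfD qfN qf_scalar subr_ge0.
have uS : S \in unitmx.
  rewrite -unitmx_tr -row_free_unit; apply/row_freeP.
  have : kermx S^T = 0.
    apply/row_matrixP => i; rewrite row0.
    have h : S *m (row i (kermx S^T))^T = 0.
      rewrite -[X in X *m _]trmxK -trmx_mul -row_mul mulmx_ker row0 trmx0//.
    have := co (row i (kermx S^T))^T; rewrite /qf -mulmxA h mulmx0 mxE.
    rewrite pmulr_rle0// => /sqn_eq0 h0.
    by rewrite -[LHS]trmxK h0 trmx0.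
  move/eqP; rewrite kermx_eq0 => /row_freeP//.
split => //; apply: mx_norm_le => [|i j]; first by rewrite invr_ge0 ltW.
pose y : 'cV[K]_m := col j (invmx S).
have Sy : S *m y = delta_mx j 0.
  by rewrite /y colE mulmxA mulmxV// mul1mx.
have := co y; rewrite /qf -mulmxA Sy -colE mxE => cy.
have yi k : y k 0 ^+ 2 <= sqn y.
  rewrite sqnE (bigD1 k)//= lerDl sumr_ge0// => l _; exact: sqr_ge0.
rewrite mxE in cy.
have Hj := le_trans (ler_wpM2l (ltW d0) (yi j)) cy.
have yj : y j 0 <= d^-1.
  rewrite -[d^-1]mul1r ler_pdivlMr// leNgt; apply/negP => h1.
  have yj0 : 0 < y j 0.
    by rewrite -(pmulr_lgt0 _ d0) (lt_trans ltr01).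
  by move: Hj; rewrite expr2 mulrA -[leRHS]mul1r ler_pM2r// mulrC leNgt h1.
have : y i 0 ^+ 2 <= d^-1 ^+ 2.
  rewrite (le_trans (yi i))// expr2 ler_pdivlMr// mulrC (le_trans cy)//.
have -> : y i 0 = invmx S i j by rewrite mxE.
by rewrite -[X in X <= _]real_normK ?num_real// ler_pXn2r ?nnegrE// invr_ge0 ltW.
Qed.

Lemma det_bound m (M : 'M[K]_m) : `|\det M| <= m`!%:R * `|M| ^+ m.
Proof.
rewrite /determinant (le_trans (ler_norm_sum _ _ _))//.
apply: (@le_trans _ _ (\sum_(s : 'S_m) `|M| ^+ m)).
  apply: ler_sum => s _; rewrite normrM normrX normrN1 expr1n mul1r normr_prod.
  rewrite -[X in _ ^+ X](card_ord m) -prodr_const.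
  by apply: ler_prod => i _; rewrite normr_ge0 mx_norm_entry.
by rewrite sumr_const card_Sn mulr_natl.
Qed.

(** The inverse is bounded by 1/d, so the Leibniz formula bounds its determinant from above, which
    keeps that of [S] away from 0 uniformly. *)
Lemma coercive_det m (d : K) : 0 < d ->
  exists2 c : K, 0 < c & forall S : 'M[K]_m, d%:M <=L S -> c <= \det S ^+ 2.
Proof.
move=> d0; pose b := m`!%:R * d^-1 ^+ m.
have b0 : 0 < b by rewrite mulr_gt0 ?ltr0n ?fact_gt0// exprn_gt0// invr_gt0.
exists (b^-1 ^+ 2) => [|S dS]; first by rewrite exprn_gt0// invr_gt0.
have [uS iS] := coercive_unitmx d0 dS.
have db : `|\det (invmx S)| <= b.
  rewrite (le_trans (det_bound _))// ler_wpM2l//.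
  by rewrite lerXn2r ?nnegrE// invr_ge0 ltW.
have dSi : \det S * \det (invmx S) = 1 by rewrite -det_mulmx mulmxV// det1.
rewrite -[leRHS]real_normK ?num_real// ler_pXn2r ?nnegrE ?invr_ge0 ?(ltW b0)//.
rewrite -[b^-1]mul1r ler_pdivrMr// -[1](@normr1 K) -dSi normrM ler_wpM2l//.
Qed.

(* Equals the inverse where [c <= det^2], yet is Lipschitz on bounded sets of all matrices. *)
Definition reg_inv m (c : K) (S : 'M[K]_m) : 'M[K]_m :=
  (\det S * (Num.max (\det S * \det S) c)^-1) *: \adj S.

Lemma reg_invE m c (S : 'M[K]_m) : S \in unitmx -> c <= \det S ^+ 2 ->
  reg_inv c S = invmx S.
Proof.
move=> uS cS; rewrite /reg_inv -expr2 max_l// /invmx uS.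
congr (_ *: _); rewrite expr2 invfM mulrA divff ?mul1r//.
by rewrite -unitfE.
Qed.

Lemma BLM_reg_inv (Z : topologicalType) (W : normedModType K) m c
    (f : Z -> W -> 'M[K]_m) : 0 < c -> bounded_lipschitz_mx f ->
  bounded_lipschitz_mx (fun z w => reg_inv c (f z w)).
Proof.
move=> c0 fB; apply: BLM_scale; last exact: BLM_adj.
apply: BL_mul; first exact: BL_det.
apply: (BL_inv c0) => [z w|]; first by rewrite le_max lexx orbT.
by apply: BL_max; apply: BL_mul; exact: BL_det.
Qed.

(** Unlike [mxE], this rule and the next leave matrix products folded, so that [ring] can treat
    their entries as atoms. *)
Lemma add_mxE p q (M N : 'M[K]_(p, q)) i j : (M + N) i j = M i j + N i j.
Proof. by rewrite mxE. Qed.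

Lemma opp_mxE p q (M : 'M[K]_(p, q)) i j : (- M) i j = - M i j.
Proof. by rewrite mxE. Qed.

Section Trunc.
Context {n m : nat}.
Implicit Types (A C Q X p : 'M[K]_n) (B D : 'M[K]_(n, m)) (R : 'M[K]_m).

Definition feedback B C D R p : 'M[K]_(m, n) :=
  - invmx (R + D^T *m p *m D) *m (B^T *m p + D^T *m p *m C).

Definition cut (M : K) p : 'M[K]_n := map_mx (clamp (- M) M) p.

Lemma cut_id (M : K) p : `|p| <= M -> cut M p = p.
Proof.
move=> pM; apply/matrixP => i j; rewrite mxE clamp_id// -ler_norml.
exact: le_trans (mx_norm_entry _ _ _) pM.
Qed.

(* The scalar factor vanishes once [M + 1 <= |p|], so at a positive semidefinite
   [p] this is always the feedback scaled by some number in [0, 1]. *)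
Definition trunc_feedback (c M : K) B C D R p : 'M[K]_(m, n) :=
  clamp 0 1 (M + 1 - `|p|) *:
    - (reg_inv c (R + D^T *m cut (M + 1) p *m D)
       *m (B^T *m cut (M + 1) p + D^T *m cut (M + 1) p *m C)).

(** For [|p| <= M + 1] the cut is inactive, and positivity of [p] makes the matrix to invert
    coercive, so the regularized inverse is the true one. For larger [p] both sides are 0. *)
Lemma trunc_feedbackE (c M d : K) B C D R p : 0 < d -> 0 <= M ->
  (forall S : 'M[K]_m, d%:M <=L S -> c <= \det S ^+ 2) ->
  d%:M <=L R -> SymPos p ->
  exists l, [/\ 0 <= l <= 1, trunc_feedback c M B C D R p = l *: feedback B C D R p &
     `|p| <= M -> l = 1].
Proof.
move=> d0 M0 cdet dR pp; exists (clamp 0 1 (M + 1 - `|p|)).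
have l01 : 0 <= clamp 0 1 (M + 1 - `|p|) <= 1 by exact: clampP.
split => //.
- rewrite /trunc_feedback.
  have [pM|pM] := leP `|p| (M + 1).
    rewrite cut_id// /feedback mulNmx reg_invE//.
      apply: (coercive_unitmx d0 _).1.
      rewrite /loewner_le addrAC; apply: SymPosD => //; exact: SymPos_congr.
    apply: cdet.
    rewrite /loewner_le addrAC; apply: SymPosD => //; exact: SymPos_congr.
  have -> : clamp 0 1 (M + 1 - `|p|) = 0.
    rewrite /clamp; apply/eqP; rewrite eq_le le_max lexx orbT andbT ge_max lexx andbT.
    by rewrite ge_min subr_le0 ltW.
  by rewrite !scale0r.
- move=> pM; rewrite /clamp min_r ?max_l//.
  by rewrite lerBrDr addrC lerD2r.
Qed.

Lemma BLM_trunc_feedback (Z : topologicalType) (W : normedModType K) (c M : K)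
    (B D : Z -> 'M[K]_(n, m)) (C : Z -> 'M[K]_n) (R : Z -> 'M[K]_m)
    (g : W -> 'M[K]_n) : 0 < c -> 0 <= M ->
  (forall w w', `|g w - g w'| <= 1 * `|w - w'|) ->
  bounded_lipschitz_mx (fun z (_ : W) => B z) ->
  bounded_lipschitz_mx (fun z (_ : W) => C z) ->
  bounded_lipschitz_mx (fun z (_ : W) => D z) ->
  bounded_lipschitz_mx (fun z (_ : W) => R z) ->
  bounded_lipschitz_mx
    (fun z w => trunc_feedback c M (B z) (C z) (D z) (R z) (g w)).
Proof.
move=> c0 M0 gL bB bC bD bR.
have M1 : 0 <= M + 1 by rewrite addr_ge0.
have cB : bounded_lipschitz_mx (fun (_ : Z) w => cut (M + 1) (g w)).
  exact: BLM_clamp M1 ler01 gL.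
apply: BLM_scale.
  apply: (BL_clamp ler01 ler01) => w w'.
  apply: le_trans (gL w w'); rewrite opprB addrC addrA subrK distrC.
  exact: ler_dist_dist.
apply: BLM_opp; apply: BLM_mul.
  apply: (BLM_reg_inv c0); apply: BLM_add => //.
  by apply: BLM_mul => //; apply: BLM_mul => //; exact: BLM_tr.
apply: BLM_add; first by apply: BLM_mul => //; exact: BLM_tr.
by apply: BLM_mul => //; apply: BLM_mul => //; exact: BLM_tr.
Qed.

(** The equation says that the derivative in s is minus this expression; in reversed time it is the
    derivative itself. *)
Definition rhs A B C D Q R X (th : 'M[K]_(m, n)) : 'M[K]_n :=
  X *m (A + B *m th) + (A + B *m th)^T *m X
  + (C + D *m th)^T *m X *m (C + D *m th) + Q + th^T *m R *m th.

(* The feedback minimizes the quadratic [rhs] in its last argument, and along the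
   segment from 0 to the minimizer a convex quadratic stays below its value at 0. *)
Lemma qf_rhs_le (d l : K) A B C D Q R X x : 0 < d -> 0 <= l <= 1 ->
  d%:M <=L R -> SymPos X ->
  qf (rhs A B C D Q R X (l *: feedback B C D R X)) x <=
  qf (X *m A + A^T *m X + C^T *m X *m C + Q) x.
Proof.
move=> d0 /andP[l0 l1] dR pX.
pose S := R + D^T *m X *m D; pose b := B^T *m X + D^T *m X *m C.
set Th := feedback B C D R X.
have dS : d%:M <=L S.
  by rewrite /loewner_le addrAC; apply: SymPosD => //; exact: SymPos_congr.
have [uS _] := coercive_unitmx d0 dS.
have STh : S *m Th = - b by rewrite /Th /feedback -/S -/b mulNmx mulmxN mulmxA mulmxV// mul1mx.
have id th : rhs A B C D Q R X th = (X *m A + A^T *m X + C^T *m X *m C + Q) +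
    (b^T *m th + th^T *m b + th^T *m S *m th).
  rewrite /rhs /b /S !linearD/= !trmx_mul !trmxK pX.1.
  rewrite !(mulmxDl, mulmxDr) !mulmxA.
  by apply/matrixP => i j; rewrite !add_mxE; ring.
rewrite id qfD gerDl !qfD.
have bTh : qf (Th^T *m b) x = - qf S (Th *m x).
  rewrite -qf_congr -mulmxA STh mulmxN qfN opprK//.
have bTh' : qf (b^T *m Th) x = - qf S (Th *m x).
  rewrite -bTh /qf -[in LHS](trmxK (x^T *m _ *m x)) mxE !trmx_mul !trmxK !mulmxA//.
rewrite -scalemxAr [(_ *: _)^T]linearZ/= -!scalemxAl -scalemxAr !qfZ bTh bTh'.
rewrite [qf (_ *m S *m Th) x]qf_congr.
have S0 : 0 <= qf S (Th *m x).
  have := dS.2 (Th *m x); rewrite -/(qf _ _) qfD qfN qf_scalar subr_ge0.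
  by apply: le_trans; rewrite mulr_ge0 ?sqn_ge0// ltW.
set s := qf S _ in S0 *.
(* By the normal equation [STh] each cross term is [- l * s] and the quadratic term is
   [l * l * s]. *)
rewrite (_ : _ + _ = - (l * (2 - l) * s)); last by ring.
by rewrite oppr_le0 !mulr_ge0// subr_ge0 (le_trans l1)// ler1n.
Qed.

End Trunc.
End Feedback.

(** * Derivatives relative to an interval, and time reversal *)

Section DerivativeIn.
Context {K : realType}.

Lemma mx_derive_has_derivative_in p q (f : K -> 'M[K]_(p, q)) (S : set K) (x : K) l :
  mx_derive f x l -> has_derivative_in S f x l.
Proof.
move=> fl P lP; have := mx_derive_quotient fl lP => {}lP.
have yx : (y - x) @[y --> x] --> x - x.
  by apply: cvgB; [exact: cvg_id|exact: cvg_cst].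
rewrite subrr in yx.
have {}yx : \forall y \near x, y - x != 0 ->
    P ((y - x)^-1 *: (f (x + (y - x)) - f x)) by exact: yx _ lP.
rewrite /= /within/= /nbhs/= /within/=.
apply: filterS yx => y Py yx0 Sy.
by move: Py; rewrite [x + _]addrC subrK subr_eq0; apply.
Qed.

(** The strict inequalities matter: at an endpoint the relative derivative is only one-sided. *)
Lemma has_derivative_in_mx_derive p q (f : K -> 'M[K]_(p, q)) (a b x : K) l :
  a < x < b -> has_derivative_in `[a, b] f x l -> mx_derive f x l.
Proof.
move=> /andP[ax xb] fl i j.
have h : h^-1 *: (f (h *: (1 : K) + x) i j - f x i j) @[h --> (0 : K)^'] --> l i j.
  have fl' : h^-1 *: (f (x + h) - f x) @[h --> (0 : K)^'] --> l.
    move=> P lP.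
    have nP : \forall y \near x, y != x -> y \in `[a, b] ->
        P ((y - x)^-1 *: (f y - f x)).
      by have := fl _ lP; rewrite /= /within/= /nbhs/= /within/=.
    have xh : (x + h) @[h --> (0 : K)] --> x + 0.
      by apply: cvgD; [exact: cvg_cst|exact: cvg_id].
    rewrite addr0 in xh.
    have nab : \forall y \near x, y \in `]a, b[.
      by apply: near_in_itvoo; rewrite in_itv/= ax.
    have {}xh : \forall h \near (0 : K), (x + h != x -> x + h \in `[a, b] ->
        P ((x + h - x)^-1 *: (f (x + h) - f x))) /\ x + h \in `]a, b[.
      exact: xh _ (filterI nP nab).
    rewrite /= /nbhs/= /within/=.
    apply: filterS xh => h [+ hab] h0; rewrite [x + h - x]addrC addKr; apply.
      by rewrite -subr_eq0 [x + h]addrC addrK.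
    by move: hab; rewrite !in_itv/= addrC => /andP[/ltW -> /ltW ->].
  have := @cvg_entry K _ _ (_ : Filter (0 : K)^') p q _ _ i j fl'.
  rewrite [X in X @ _ --> _](_ : _ =
    fun h => h^-1 *: (f (h *: (1 : K) + x) i j - f x i j)); last first.
    by apply/funext => r; rewrite !mxE /GRing.scale/= mulr1 [r + x]addrC.
  by apply; typeclasses eauto.
by apply: DeriveDef; [exact: cvgP h|exact: cvg_lim h].
Qed.

Lemma mx_derive_reverse p q (f : K -> 'M[K]_(p, q)) (T s : K) l :
  mx_derive f (T - s) l -> mx_derive (fun r => f (T - r)) s (- l).
Proof.
move=> fl i j.
have h1 : is_derive s (1 : K) (fun r => T - r) (- 1).
  apply: is_derive_ext (is_deriveB (is_derive_cst T s (1 : K))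
    (is_derive_id s (1 : K))) => //.
  by rewrite sub0r.
have := @is_derive1_comp _ (fun r => f r i j) (fun r => T - r) s _ _ (fl i j) h1.
by apply: is_derive_ext => //; rewrite mxE mulrN1.
Qed.

End DerivativeIn.

(** * Affine growth of the right-hand side under a bounded feedback *)

Section Bounds.
Context {K : realType} {n m : nat}.

Lemma cut_norm (M : K) (X : 'M[K]_n) : 0 <= M -> `|cut M X| <= `|X|.
Proof.
move=> M0; apply: mx_norm_le => // i j; rewrite mxE.
apply: le_trans (mx_norm_entry X i j).
have h := clamp_lipschitz (- M) M (X i j) 0.
by rewrite [clamp _ _ 0]clamp_id ?subr0 in h; rewrite // oppr_le0 M0.
Qed.

Lemma closed_loop_norm (A : 'M[K]_n) (B : 'M[K]_(n, m)) th (b h : K) :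
  0 <= b -> `|A| <= b -> `|B| <= b -> `|th| <= h ->
  `|A + B *m th| <= b + m%:R * (b * h).
Proof.
move=> b0 Ab Bb thh; rewrite (le_trans (ler_normD _ _))// lerD//.
by rewrite (le_trans (mx_norm_mul _ _))// ler_wpM2l// ler_pM.
Qed.

Lemma sandwich_norm p q (N : 'M[K]_(p, q)) (X : 'M[K]_p) (k : K) :
  `|N| <= k -> `|N^T *m X *m N| <= p%:R * (p%:R * (k * `|X|) * k).
Proof.
move=> Nk; rewrite (le_trans (mx_norm_mul _ _))// ler_wpM2l// ler_pM//.
by rewrite (le_trans (mx_norm_mul _ _))// mx_norm_tr ler_wpM2l// ler_wpM2r.
Qed.

Lemma rhs_norm (A C Q X : 'M[K]_n) (B D : 'M[K]_(n, m)) R th (b h k : K) :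
  `|A| <= b -> `|B| <= b -> `|C| <= b -> `|D| <= b -> `|Q| <= b -> `|R| <= b ->
  `|th| <= h -> b + m%:R * (b * h) <= k ->
  `|rhs A B C D Q R X th| <= (2 * n%:R * k + n%:R * n%:R * k * k) * `|X|
     + (b + m%:R * (m%:R * (h * b) * h)).
Proof.
move=> Ab Bb Cb Db Qb Rb thh hk; rewrite /rhs.
have b0 : 0 <= b := le_trans (normr_ge0 _) Ab.
have h0 : 0 <= h := le_trans (normr_ge0 _) thh.
have Ak : `|A + B *m th| <= k by apply: le_trans hk; exact: closed_loop_norm.
have Ck : `|C + D *m th| <= k by apply: le_trans hk; exact: closed_loop_norm.
have B1 : `|X *m (A + B *m th)| <= n%:R * (k * `|X|).
  by rewrite (le_trans (mx_norm_mul _ _))// [k * _]mulrC ler_wpM2l// ler_wpM2l.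
have B2 : `|(A + B *m th)^T *m X| <= n%:R * (k * `|X|).
  by rewrite (le_trans (mx_norm_mul _ _))// mx_norm_tr ler_wpM2l// ler_wpM2r.
have B3 := sandwich_norm X Ck.
have B4 : `|th^T *m R *m th| <= m%:R * (m%:R * (h * b) * h).
  rewrite (le_trans (sandwich_norm R thh))// ler_wpM2l// ler_wpM2r// ler_wpM2l//.
  by rewrite ler_wpM2l.
rewrite (le_trans (ler_normD _ _))// (le_trans (lerD (ler_normD _ _) B4))//.
rewrite -addrA (le_trans (lerD (ler_normD _ _) (lexx _)))//.
rewrite (le_trans (lerD (lerD (ler_normD _ _) B3) (lerD Qb (lexx _))))//.
rewrite lerD2r (le_trans (lerD (lerD B1 B2) (lexx _)))//.
by rewrite le_eqVlt; apply/orP; left; apply/eqP; ring.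
Qed.

End Bounds.

(** * The equilibrium Riccati equation *)

Lemma common_bound (K : realType) (a1 a2 a3 a4 a5 a6 a7 : K) :
  0 < a1 -> 0 < a2 -> 0 < a3 -> 0 < a4 -> 0 < a5 -> 0 < a6 -> 0 < a7 ->
  exists2 b, 0 < b & [/\ a1 <= b, a2 <= b, a3 <= b &
    [/\ a4 <= b, a5 <= b, a6 <= b & a7 <= b]].
Proof.
move=> *; exists (a1 + a2 + a3 + a4 + a5 + a6 + a7); first by rewrite !addr_gt0.
by do 2?split; lra.
Qed.

(** The closing arithmetic of [flow_apriori], with its large quadratic forms abstracted to variables
    for [lra]. *)
Lemma apriori_arith (K : realType) (x1 x2 x3 x4 y1 y2 y3 r q z1 z2 z3 z4 : K) :
  r <= x1 + x2 + x3 + x4 -> x4 <= q -> y1 + y2 + y3 <= z4 -> z1 <= z2 -> q <= z3 ->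
  y1 - x1 + (y2 - x2) + (y3 - x3) + z1 <= z2 + z3 + z4 - r.
Proof. by move=> *; lra. Qed.

Section Equilibrium.
Context {K : realType} {n m : nat} (T : K).
Context (A C : K -> 'M[K]_n) (B D : K -> 'M[K]_(n, m)) (G : K -> 'M[K]_n).
Context (Q : K * K -> 'M[K]_n) (R : K * K -> 'M[K]_m) (delta : K).
Context (T_gt0 : 0 < T).
Context (A_cont : {within `[0, T], continuous A}).
Context (C_cont : {within `[0, T], continuous C}).
Context (B_cont : {within `[0, T], continuous B}).
Context (D_cont : {within `[0, T], continuous D}).
Context (G_cont : {within `[0, T], continuous G}).
Context (Q_cont : {within `[0, T] `*` `[0, T], continuous Q}).
Context (R_cont : {within `[0, T] `*` `[0, T], continuous R}).
Context (delta_gt0 : 0 < delta).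
Context (pos : forall t s : K, 0 <= t -> t <= s -> s <= T ->
  [/\ SymPos (Q (t, s)), delta%:M <=L R (t, s) & SymPos (G t)]).
Context (mono : forall t r s : K, 0 <= t -> t <= r -> r <= s -> s <= T ->
  [/\ Q (t, s) <=L Q (r, s), R (t, s) <=L R (r, s) & G t <=L G r]).

Local Notation V := 'M[K]_n.
Local Notation W := (V * V)%type.

Let cl := clamp 0 T.
(** A projection of the plane onto the triangle, read in reversed time. Beyond the diagonal the
    first coordinate is frozen at the second one; being nondecreasing in [z.1], it preserves the
    monotonicity of the coefficients in t. *)
Let tri (z : K * K) : K * K := (Num.min (cl z.1) (cl (T - z.2)), cl (T - z.2)).

(* Time is reversed, [s] standing for [T - s], and every coefficient is extended
   to the whole plane through its values on the triangle. *)
Let Ar s := A (cl (T - s)).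
Let Br s := B (cl (T - s)).
Let Cr s := C (cl (T - s)).
Let Dr s := D (cl (T - s)).
Let Rd s := R (cl (T - s), cl (T - s)).
Let Qr z := Q (tri z).
Let Rr z := R (tri z).

Let clP s : 0 <= cl s <= T.
Proof. by apply: clampP; rewrite ltW. Qed.

Let cl_id s : 0 <= s <= T -> cl s = s.
Proof. exact: clamp_id. Qed.

Let cl_homo s r : s <= r -> cl s <= cl r.
Proof.
move=> sr; rewrite /cl /clamp ge_max !le_max lexx orbT andbT.
by rewrite le_min !ge_min sr lexx orbT.
Qed.

Let rev s : 0 <= s <= T -> 0 <= T - s <= T.
Proof. by move=> /andP[s0 sT]; rewrite subr_ge0 sT gerBl. Qed.

Let triP z : [/\ 0 <= (tri z).1, (tri z).1 <= (tri z).2 & (tri z).2 <= T].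
Proof.
have /andP[h1 h2] := clP z.1; have /andP[h3 h4] := clP (T - z.2).
by split; rewrite //= ?le_min ?h1 ?h3// ge_min lexx orbT.
Qed.

Let tri_id t s : 0 <= t -> t <= s -> s <= T -> tri (t, T - s) = (t, s).
Proof.
move=> t0 ts sT; rewrite /tri /= subKr !cl_id ?min_l//.
  by rewrite (le_trans t0).
by rewrite t0 (le_trans ts).
Qed.

Let time_cont : continuous (fun z : K * K => cl (T - z.2)).
Proof.
move=> z; apply: (@continuous_comp _ _ _ (fun z : K * K => T - z.2) cl).
  by apply: cvgB; [exact: cvg_cst|exact: cvg_snd].
exact: clamp_continuous.
Qed.

Let clfst_cont : continuous (fun z : K * K => cl z.1).
Proof.
move=> z; apply: (@continuous_comp _ _ _ (fst : K * K -> K) cl).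
  exact: cvg_fst.
exact: clamp_continuous.
Qed.

Let tri_cont : continuous tri.
Proof.
move=> z; apply: (continuous_pair
  (f := fun z => Num.min (cl z.1) (cl (T - z.2))) (g := fun z => cl (T - z.2)));
  last exact: time_cont.
apply: (continuous_min (f := fun z : K * K => cl z.1)
  (g := fun z : K * K => cl (T - z.2))).
  exact: clfst_cont.
exact: time_cont.
Qed.

Let tri_square z : (`[0, T] `*` `[0, T]) (tri z).
Proof.
have [h1 h2 h3] := triP z; split; rewrite /= in_itv/=.
  by rewrite h1 (le_trans h2).
by rewrite h3 (le_trans h1).
Qed.

Let plane_bounded p q (f : K * K -> 'M[K]_(p, q)) (g : K * K -> K * K) :
  {within `[0, T] `*` `[0, T], continuous f} -> continuous g ->
  (forall z, (`[0, T] `*` `[0, T]) (g z)) ->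
  bounded_lipschitz_mx (fun z (_ : W) => f (g z)).
Proof.
move=> fc gc gS; apply: BLM_param; first exact: continuous_within_comp fc gc gS.
have cS : compact (`[0, T] `*` `[0, T] : set (K * K)).
  by apply: compact_setX; exact: segment_compact.
by have [L _ fL] := compact_norm_bound cS fc; exists L => z; apply: fL; exact: gS.
Qed.

Let line_bounded p q (f : K -> 'M[K]_(p, q)) (g : K * K -> K) :
  {within `[0, T], continuous f} -> continuous g -> (forall z, 0 <= g z <= T) ->
  bounded_lipschitz_mx (fun z (_ : W) => f (g z)).
Proof.
move=> fc gc gS.
have gS' z : [set` `[0, T]] (g z) by rewrite /= in_itv/=; exact: gS.
apply: BLM_param; first exact: continuous_within_comp fc gc gS'.
have [L _ fL] := compact_norm_bound (@segment_compact _ 0 T) fc.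
by exists L => z; apply: fL; exact: gS'.
Qed.

Let BL_A : bounded_lipschitz_mx (fun (z : K * K) (_ : W) => Ar z.2).
Proof. exact: line_bounded A_cont time_cont (fun=> clP _). Qed.
Let BL_B : bounded_lipschitz_mx (fun (z : K * K) (_ : W) => Br z.2).
Proof. exact: line_bounded B_cont time_cont (fun=> clP _). Qed.
Let BL_C : bounded_lipschitz_mx (fun (z : K * K) (_ : W) => Cr z.2).
Proof. exact: line_bounded C_cont time_cont (fun=> clP _). Qed.
Let BL_D : bounded_lipschitz_mx (fun (z : K * K) (_ : W) => Dr z.2).
Proof. exact: line_bounded D_cont time_cont (fun=> clP _). Qed.
Let BL_G : bounded_lipschitz_mx (fun (z : K * K) (_ : W) => G (cl z.1)).
Proof. exact: line_bounded G_cont clfst_cont (fun=> clP _). Qed.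
Let BL_Q : bounded_lipschitz_mx (fun z (_ : W) => Qr z).
Proof. exact: plane_bounded Q_cont tri_cont tri_square. Qed.
Let BL_R : bounded_lipschitz_mx (fun z (_ : W) => Rr z).
Proof. exact: plane_bounded R_cont tri_cont tri_square. Qed.
Let BL_Rd : bounded_lipschitz_mx (fun (z : K * K) (_ : W) => Rd z.2).
Proof.
apply: (plane_bounded R_cont (g := fun z => (cl (T - z.2), cl (T - z.2)))) => z.
  by apply: (continuous_pair (f := fun z => cl (T - z.2))
    (g := fun z => cl (T - z.2))); exact: time_cont.
by split; rewrite /= in_itv/=; exact: clP.
Qed.

Let th (c M s : K) (p : V) : 'M[K]_(m, n) :=
  trunc_feedback c M (Br s) (Cr s) (Dr s) (Rd s) p.

(** [w.1] stands for the value at (t, s), which enters linearly, and [w.2] for the diagonal value,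
    which enters through the feedback. Their cut-off radii differ because in the existence proof
    [M'] is computed from a feedback bound that depends on [M]. *)
Let F (c M M' : K) (z : K * K) (w : W) : V :=
  rhs (Ar z.2) (Br z.2) (Cr z.2) (Dr z.2) (Qr z) (Rr z) (cut M' w.1) (th c M z.2 w.2).

Let BL_th c M : 0 < c -> 0 <= M ->
  bounded_lipschitz_mx (fun (z : K * K) (w : W) => th c M z.2 w.2).
Proof.
move=> c0 M0; apply: BLM_trunc_feedback => // w w'.
by rewrite mul1r prod_normE /= le_max lexx orbT.
Qed.

Let BL_F c M M' : 0 < c -> 0 <= M -> 0 <= M' -> bounded_lipschitz_mx (F c M M').
Proof.
move=> c0 M0 M'0; have bth := BL_th c0 M0.
have bX : bounded_lipschitz_mx (fun (_ : K * K) (w : W) => cut M' w.1).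
  apply: (BLM_clamp (g := fun w : W => w.1) M'0 ler01) => w w'.
  by rewrite mul1r prod_normE /= le_max lexx.
have bA : bounded_lipschitz_mx (fun (z : K * K) (w : W) => Ar z.2 + Br z.2 *m th c M z.2 w.2).
  by apply: BLM_add => //; exact: BLM_mul.
have bC : bounded_lipschitz_mx (fun (z : K * K) (w : W) => Cr z.2 + Dr z.2 *m th c M z.2 w.2).
  by apply: BLM_add => //; exact: BLM_mul.
apply: BLM_add; last by apply: BLM_mul => //; apply: BLM_mul => //; exact: BLM_tr.
apply: BLM_add => //; apply: BLM_add; last first.
  by apply: BLM_mul => //; apply: BLM_mul => //; exact: BLM_tr.
by apply: BLM_add; apply: BLM_mul => //; exact: BLM_tr.
Qed.

Let data_bound : exists2 b : K, 0 < b & forall t s,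
  [/\ `|Ar s| <= b /\ `|Br s| <= b, `|Cr s| <= b /\ `|Dr s| <= b,
      `|Qr (t, s)| <= b, `|Rr (t, s)| <= b & `|G (cl t)| <= b].
Proof.
have [_ [a1 p1 h1] _] := BLM_norm BL_A; have [_ [a2 p2 h2] _] := BLM_norm BL_B.
have [_ [a3 p3 h3] _] := BLM_norm BL_C; have [_ [a4 p4 h4] _] := BLM_norm BL_D.
have [_ [a5 p5 h5] _] := BLM_norm BL_Q; have [_ [a6 p6 h6] _] := BLM_norm BL_R.
have [_ [a7 p7 h7] _] := BLM_norm BL_G.
have [b b0 [b1 b2 b3 [b4 b5 b6 b7]]] := common_bound p1 p2 p3 p4 p5 p6 p7.
exists b => // t s.
by split; [split|split| | |];
  [exact: le_trans (h1 (t, s) 0) b1|exact: le_trans (h2 (t, s) 0) b2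
  |exact: le_trans (h3 (t, s) 0) b3|exact: le_trans (h4 (t, s) 0) b4
  |exact: le_trans (h5 (t, s) 0) b5|exact: le_trans (h6 (t, s) 0) b6
  |exact: le_trans (h7 (t, s) 0) b7].
Qed.

Let coercive_SymPos (S : 'M[K]_m) : delta%:M <=L S -> SymPos S.
Proof.
move=> dS; rewrite -(subrK delta%:M S); apply: SymPosD => //.
by apply: SymPos_scalar; exact: ltW.
Qed.

Let Q_pos z : SymPos (Qr z).
Proof. by have [h1 h2 h3] := triP z; have [] := pos h1 h2 h3. Qed.
Let R_pos z : SymPos (Rr z).
Proof.
by have [h1 h2 h3] := triP z; have [_ h _] := pos h1 h2 h3; exact: coercive_SymPos.
Qed.
Let Rd_pos s : delta%:M <=L Rd s.
Proof. by have /andP[h1 h2] := clP (T - s); have [] := pos h1 (lexx _) h2. Qed.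
Let G_pos t : SymPos (G (cl t)).
Proof. by have /andP[h1 h2] := clP t; have [] := pos h1 (lexx _) h2. Qed.

Let data_mono t r s : t <= r ->
  [/\ Qr (t, s) <=L Qr (r, s), Rr (t, s) <=L Rr (r, s) & G (cl t) <=L G (cl r)].
Proof.
move=> tr.
have [h1 _ h3] := triP (t, s); have [_ h2 _] := triP (r, s).
have tri_le : (tri (t, s)).1 <= (tri (r, s)).1.
  by rewrite /= le_min !ge_min cl_homo//= lexx orbT.
have [q1 q2 _] := mono h1 tri_le h2 h3.
have /andP[t0 _] := clP t; have /andP[_ rT] := clP r.
have [_ _ g1] := mono t0 (cl_homo tr) (lexx _) rT.
by split.
Qed.

(** * The linear flow generated by a given bounded feedback *)

Section Flow.
Context (X : K -> K -> V) (u : K -> 'M[K]_(m, n)) (h : K).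
Context (X_der : forall t s, 0 <= s <= T -> mx_derive (X t) s
  (rhs (Ar s) (Br s) (Cr s) (Dr s) (Qr (t, s)) (Rr (t, s)) (X t s) (u s))).
Context (X_0 : forall t, X t 0 = G (cl t)).
Context (u_bound : forall s, 0 <= s <= T -> `|u s| <= h).

Let closed_loop_bound : exists2 L : K, 0 <= L & forall s, 0 <= s <= T ->
  `|Ar s + Br s *m u s| <= L /\ `|Cr s + Dr s *m u s| <= L.
Proof.
have [b b0 hb] := data_bound.
have h0 : 0 <= h.
  by apply: le_trans (u_bound (s := 0) _); rewrite // lexx ltW.
exists (b + m%:R * (b * h)) => [|s sT].
  by rewrite addr_ge0 ?mulr_ge0// ltW.
have [[Ab Bb] [Cb Db] _ _ _] := hb 0 s.
by split; apply: closed_loop_norm => //; rewrite ?(ltW b0) ?u_bound.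
Qed.

(** With [u] a known function of time this is a Lyapunov equation with positive source Q + u^T R u.
    Positivity is thus available before [u] is identified with a feedback. *)
Lemma flow_pos t s : 0 <= s <= T -> SymPos (X t s).
Proof.
have [L L0 hL] := closed_loop_bound.
apply: (lyapunov_psd (T := T) (L := L) (Z := X t)
  (A := fun s => Ar s + Br s *m u s) (C := fun s => Cr s + Dr s *m u s)
  (N := fun s => Qr (t, s) + (u s)^T *m Rr (t, s) *m u s)) => //.
- exact: ltW.
- move=> r rT; apply: mx_derive_ext (X_der t rT) => //.
  by rewrite /rhs !addrA.
- by move=> r _; apply: SymPosD => //; exact: SymPos_congr.
- by rewrite X_0.
Qed.

(** The feedback does not depend on the first argument, so the difference of two slices solves a
    Lyapunov equation whose source comes from the monotone differences of Q and R. *)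
Lemma flow_mono t r s : t <= r -> 0 <= s <= T -> X t s <=L X r s.
Proof.
move=> tr; have [L L0 hL] := closed_loop_bound.
apply: (lyapunov_psd (T := T) (L := L) (Z := fun s => X r s - X t s)
  (A := fun s => Ar s + Br s *m u s) (C := fun s => Cr s + Dr s *m u s)
  (N := fun s => (Qr (r, s) - Qr (t, s)) +
     (u s)^T *m (Rr (r, s) - Rr (t, s)) *m u s)) => //.
- exact: ltW.
- move=> x xT; apply: mx_derive_ext (mx_deriveB (X_der r xT) (X_der t xT)) => //.
  rewrite /rhs; set a := Ar x + _; set d := Cr x + _.
  rewrite !(mulmxBl, mulmxBr).
  by apply/matrixP => i j; rewrite !(add_mxE, opp_mxE); ring.
- move=> x _; have [q r' _] := data_mono x tr.
  by apply: SymPosD => //; exact: SymPos_congr.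
- by rewrite !X_0; have [] := data_mono 0 tr.
Qed.

Context (X_cont : continuous (fun z : K * K => X z.1 (cl z.2))).
Context (u_feedback : forall s, 0 <= s <= T -> exists2 l, 0 <= l <= 1 &
  u s = l *: feedback (Br s) (Cr s) (Dr s) (Rd s) (X (T - s) s)).


(** Continuous induction against a scalar barrier times the identity. From time s the slice t = T -
    s is followed: at s itself its right-hand side is at most that of zero feedback, so
    [lyapunov_step] keeps it under the barrier for a while, and monotonicity in t passes this on to
    the moving diagonal. *)
Lemma flow_apriori b : 0 < b ->
  (forall t s, [/\ `|Ar s| <= b, `|Cr s| <= b, `|Qr (t, s)| <= b & `|G (cl t)| <= b]) ->
  forall s, 0 <= s <= T -> forall x,
  qf (X (T - s) s) x <= (1 + n%:R * b) *
    expR ((1 + n%:R * b + n%:R * (2 * b + n%:R * (b * b))) * s) * sqn x.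
Proof.
move=> b0 hb.
(* In [k], the 1 yields the margin of [lyapunov_step], [n%:R * b] dominates Q because the barrier is
   at least 1, and the rest bounds the Lyapunov operator at the identity. The value [a] dominates G
   and is at least 1. *)
set k := 1 + n%:R * b + _; set a := 1 + n%:R * b.
have nb0 : 0 <= n%:R * b by rewrite mulr_ge0// ltW.
have a1 : 1 <= a by rewrite lerDl.
have k0 : 0 <= k by rewrite !addr_ge0// mulr_ge0// addr_ge0 ?mulr_ge0// ltW.
apply: (@real_induction K T (fun s => forall x,
  qf (X (T - s) s) x <= a * expR (k * s) * sqn x)).
- move=> x; rewrite X_0 mulr0 expR0 mulr1 (le_trans (qf_le _ _))// ler_wpM2r ?sqn_ge0//.
  have [_ _ _ Gb] := hb (T - 0) 0.
  by rewrite /a (le_trans (ler_wpM2l _ Gb))// lerDr.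
- move=> s /andP[s0 sltT] IH.
  have sT : 0 <= s <= T by rewrite s0 ltW.
  set t := T - s in IH *.
  pose Z r := (a * expR (k * r)) *: 1%:M - X t r.
  have ZP r x : qf (Z r) x = a * expR (k * r) * sqn x - qf (X t r) x.
    by rewrite /Z qfD qfN qfZ qf_scalar mul1r.
  have dZ := mx_deriveB (mx_deriveZ 1%:M (is_derive_exp a k s)) (X_der t sT).
  have Z0 x : 0 <= qf (Z s) x by rewrite ZP subr_ge0; exact: IH.
  have [|e e0 he] := lyapunov_step (Z := Z) (A := Ar s) (C := Cr s) ltr01 dZ Z0.
    move=> x; have [Ab Cb Qb _] := hb t s.
    have [l l01 ul] := u_feedback sT.
    (* The feedback is built from the weight R(s,s), so it minimizes the right-hand side only where
       the running weight is the same, on the diagonal. *)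
    have RrE : Rr (t, s) = Rd s by rewrite /Rr /Rd /tri /= minxx.
    have := qf_rhs_le (Ar s) (Br s) (Cr s) (Dr s) (Qr (t, s)) x
      delta_gt0 l01 (Rd_pos s) (flow_pos t sT).
    rewrite RrE -[feedback _ _ _ _ _]/(feedback (Br s) (Cr s) (Dr s) (Rd s) (X (T - s) s)) -ul.
    set q := rhs _ _ _ _ _ _ _ _ => hq.
    have E1 : 1 <= a * expR (k * s).
      by rewrite -[leLHS]mul1r ler_pM// expRM_ge1.
    rewrite /Z qfD [qf (- q) x]qfN qfZ qf_scalar !mul1r.
    move: E1 hq; set E := a * expR (k * s) => E1 hq.
    rewrite !mulmxBl !mulmxBr !mulmxBl -!scalemxAl -!scalemxAr !mul1mx !mulmx1.
    rewrite -scalemxAl !qfD !qfN !qfZ.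
    rewrite !qfD in hq.
    have hQ : qf (Qr (t, s)) x <= n%:R * b * sqn x.
      by rewrite (le_trans (qf_le _ _))// ler_wpM2r ?sqn_ge0// ler_wpM2l.
    have hA : qf (Ar s) x + qf (Ar s)^T x + qf ((Cr s)^T *m Cr s) x <=
        n%:R * (2 * b + n%:R * (b * b)) * sqn x.
      rewrite -!qfD (le_trans (qf_le _ _))// ler_wpM2r ?sqn_ge0// ler_wpM2l//.
      rewrite (le_trans (ler_normD _ _))// lerD//.
        by rewrite (le_trans (ler_normD _ _))// mx_norm_tr mulr_natl mulr2n lerD.
      by rewrite (le_trans (mx_norm_mul _ _))// mx_norm_tr ler_wpM2l// ler_pM.
    have E0 : 0 <= E by rewrite (le_trans _ E1).
    have hEA := ler_wpM2l E0 hA; rewrite !mulrDr in hEA.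
    have hE1 : sqn x <= E * sqn x by rewrite ler_peMl// sqn_ge0.
    have hE2 : n%:R * b * sqn x <= E * (n%:R * b * sqn x).
      by rewrite ler_peMl// mulr_ge0// sqn_ge0.
    have -> : k * E * sqn x = E * sqn x + E * (n%:R * b * sqn x) +
        E * (n%:R * (2 * b + n%:R * (b * b)) * sqn x) by rewrite /k; ring.
    rewrite !mulrDr; move: hq hQ hEA hE1 hE2.
    exact: apriori_arith.
  exists (Num.min e (T - s)) => [|r]; first by rewrite lt_min e0 subr_gt0.
  rewrite le_min => /andP[r0 /andP[re rT]] x.
  have srT : 0 <= s + r <= T by rewrite addr_ge0//= addrC -lerBrDr.
  have := he r; rewrite r0 re => /(_ isT x); rewrite ZP subr_ge0; apply: le_trans.
  (* As reversed time advances, the first argument of the diagonal decreases, which is the direction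
     in which monotonicity helps. *)
  have tt : T - (s + r) <= t by rewrite /t lerD2l lerN2 lerDl.
  have := (flow_mono tt srT).2 x; rewrite -/(qf _ _) qfD qfN subr_ge0//.
- move=> s /andP[s0 sT] below x; rewrite -subr_ge0.
  have s0T : 0 <= s <= T by rewrite ltW.
  pose f r := a * expR (k * r) * sqn x - qf (X (T - r) (cl r)) x.
  have fE r : 0 <= r <= T -> a * expR (k * r) * sqn x - qf (X (T - r) r) x = f r.
    by move=> rT; rewrite /f cl_id.
  rewrite fE//; apply: (ge0_left_closed s0) => [|r /andP[r0 rs]]; last first.
    rewrite -fE ?subr_ge0 ?below ?r0 ?rs//.
    by rewrite (le_trans (ltW rs)).
  apply: cvgB.
    apply: cvgM; last exact: cvg_cst.
    have /derivable1_diffP/differentiable_continuous hc :=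
      @ex_derive _ _ _ _ _ _ _ (is_derive_exp a k s).
    exact: hc.
  apply: continuous_qf.
  apply: (@continuous_comp _ _ _ (fun r : K => (T - r, r)) (fun z : K * K => X z.1 (cl z.2))).
    apply: (continuous_pair (f := fun r => T - r) (g := fun r => r)); last exact: cvg_id.
    by apply: cvgB; [exact: cvg_cst|exact: cvg_id].
  exact: X_cont.
Qed.

End Flow.
Lemma reversed_existence : exists (X : K -> K -> V) (u : K -> 'M[K]_(m, n)),
  [/\ continuous (fun z : K * K => X z.1 (cl z.2)),
      forall t, X t 0 = G (cl t),
      forall t s, 0 <= s <= T -> SymPos (X t s) /\ mx_derive (X t) s
        (rhs (Ar s) (Br s) (Cr s) (Dr s) (Qr (t, s)) (Rr (t, s)) (X t s) (u s)),
      continuous u &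
      forall s, 0 <= s <= T ->
        u s = feedback (Br s) (Cr s) (Dr s) (Rd s) (X (T - s) s)].
Proof.
have [c c0 cdet] := coercive_det m delta_gt0.
have [b b0 hb] := data_bound.
have nb0 : 0 <= n%:R * b by rewrite mulr_ge0// ltW.
pose kp := 1 + n%:R * b + n%:R * (2 * b + n%:R * (b * b)).
have kp0 : 0 <= kp by rewrite !addr_ge0// mulr_ge0// addr_ge0 ?mulr_ge0// ltW.
(* This is the bound of [flow_apriori] at the final time and involves the data only. The bound [h]
   of the truncated feedback depends on [M], and [M'] on [h], so the choices are not circular. *)
pose M := (1 + n%:R * b) * expR (kp * T).
have M0 : 0 <= M by rewrite mulr_ge0 ?expR_ge0// addr_ge0.
have bth := BL_th c0 M0.
have [thc [h h0 hth] _] := BLM_norm bth.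
pose k := b + m%:R * (b * h).
have k0 : 0 <= k by rewrite addr_ge0 ?mulr_ge0// ltW.
pose a := 1 + (2 * n%:R * k + n%:R * n%:R * k * k).
pose bt := b + m%:R * (m%:R * (h * b) * h).
have a1 : 1 <= a by rewrite lerDl addr_ge0// !mulr_ge0.
have bt0 : 0 <= bt by rewrite addr_ge0 ?mulr_ge0// ltW.
pose M' := (b + bt) * expR (2 * a * T).
have M'0 : 0 <= M' by rewrite mulr_ge0 ?expR_ge0// addr_ge0// ltW.
have Gc : continuous (fun t => G (cl t)).
  have clD t : [set` `[0, T]] (cl t) by rewrite /= in_itv/=; exact: clP.
  have cc : continuous cl by move=> t; exact: clamp_continuous.
  exact: (continuous_within_comp G_cont cc clD).
have [X [Xc X0 dX]] := picard T_gt0 Gc (BL_F c0 M0 M'0).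
(* This removes the cut of the linear argument, so that [X] solves a genuine linear equation with
   feedback [u] and the flow lemmas apply. *)
have XM' t s : 0 <= s <= T -> `|X t s| <= M'.
  move=> sT; have /andP[s0 sleT] := sT.
  have a0 : 0 < a by rewrite (lt_le_trans ltr01).
  have := @gronwall K n n (X t) (fun s => F c M M' (t, s) (X t s, X (T - s) s)) T
    a bt (b + bt) (ltW T_gt0) a0 _ _ (dX t) _ _ s sT.
  move=> gr; apply: (le_trans (gr _ _ _ _)).
  - by rewrite addr_ge0// ltW.
  - by rewrite -[leLHS]mul1r ler_pM// lerDr ltW.
  - move=> x xT; have [[Ab Bb] [Cb Db] Qb Rb _] := hb t x.
    have := rhs_norm (cut M' (X t x)) Ab Bb Cb Db Qb Rb
      (hth (t, x) (X t x, X (T - x) x)) (lexx k).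
    move=> hr; apply: le_trans hr _; rewrite lerD2r.
    apply: (@le_trans _ _ (a * `|cut M' (X t x)|)).
      by rewrite ler_wpM2r// lerDr.
    by rewrite ler_wpM2l ?cut_norm// (le_trans ler01).
  - by rewrite X0 (le_trans (y := b)) ?lerDl//; have [] := hb t 0.
  - have bbt : 0 <= b + bt by rewrite addr_ge0// ltW.
    rewrite /M'; apply: (ler_wpM2l bbt); rewrite ler_expR ler_wpM2l//.
    by rewrite mulr_ge0// (le_trans ler01).
pose u s := th c M s (X (T - s) (cl s)).
have uE s : 0 <= s <= T -> u s = th c M s (X (T - s) s) by move=> sT; rewrite /u cl_id.
have X_der t s : 0 <= s <= T -> mx_derive (X t) s
    (rhs (Ar s) (Br s) (Cr s) (Dr s) (Qr (t, s)) (Rr (t, s)) (X t s) (u s)).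
  move=> sT; rewrite uE// -[X in rhs _ _ _ _ _ _ X _](cut_id (XM' t s sT)).
  exact: (dX t s sT).
have uh s : 0 <= s <= T -> `|u s| <= h.
  by move=> _; exact: (hth (0, s) (0, X (T - s) (cl s))).
have Xpos t s := flow_pos X_der X0 uh t (s := s).
have u_l s : 0 <= s <= T -> exists l, [/\ 0 <= l <= 1,
    u s = l *: feedback (Br s) (Cr s) (Dr s) (Rd s) (X (T - s) s) &
    `|X (T - s) s| <= M -> l = 1].
  move=> sT; rewrite uE//.
  exact: (trunc_feedbackE _ _ _ delta_gt0 M0 cdet (Rd_pos s) (Xpos (T - s) s sT)).
exists X, u; split=> //.
- by move=> t s sT; split; [exact: Xpos|exact: X_der].
- move=> s; apply: (@continuous_comp _ _ _
    (fun s : K => ((0 : K, s), (0 : V, X (T - s) (cl s))))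
    (fun z : (K * K) * W => th c M z.1.2 z.2.2)); last exact: thc.
  apply: (continuous_pair (f := fun s => (0 : K, s))
    (g := fun s => (0 : V, X (T - s) (cl s)))).
    by apply: (continuous_pair (f := fun=> (0 : K)) (g := id)); [exact: cvg_cst|exact: cvg_id].
  apply: (continuous_pair (f := fun=> (0 : V)) (g := fun s => X (T - s) (cl s))).
    exact: cvg_cst.
  apply: (@continuous_comp _ _ _ (fun r : K => (T - r, r)) (fun z : K * K => X z.1 (cl z.2))).
    apply: (continuous_pair (f := fun r => T - r) (g := fun r => r)); last exact: cvg_id.
    by apply: cvgB; [exact: cvg_cst|exact: cvg_id].
  exact: Xc.
- move=> s sT; have [l [l01 -> l1]] := u_l s sT.
  (* Inside the ball of radius [M] the truncation factor is 1; the a priori bound holds for any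
     factor in [0, 1], so it may be used to get there. *)
  suff XM : `|X (T - s) s| <= M by rewrite l1// scale1r.
  apply: (SymPos_norm_le M0 (Xpos (T - s) s sT)) => x.
  have hb' t r : [/\ `|Ar r| <= b, `|Cr r| <= b, `|Qr (t, r)| <= b & `|G (cl t)| <= b].
    by have [[? _] [? _] ? _ ?] := hb t r.
  have uf r : 0 <= r <= T -> exists2 l, 0 <= l <= 1 &
      u r = l *: feedback (Br r) (Cr r) (Dr r) (Rd r) (X (T - r) r).
    by move=> rT; have [l' [? ? _]] := u_l r rT; exists l'.
  have := flow_apriori X_der X0 uh Xc uf b0 hb' sT x => hx.
  apply: (le_trans hx); rewrite -/kp ler_wpM2r ?sqn_ge0// ler_wpM2l ?addr_ge0//.
  by rewrite ler_expR ler_wpM2l//; have /andP[] := sT.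
Qed.

(** * Return to the original time: existence and uniqueness *)

Let Delta_tri z : Delta 0 T (tri z).
Proof.
have [h1 h2 h3] := triP z; split => //; first by rewrite h1 (le_trans h2).
by rewrite h3 (le_trans h1).
Qed.

Let DeltaE t s : Delta 0 T (t, s) -> [/\ 0 <= t, t <= s & s <= T].
Proof. by move=> [/andP[t0 _] /andP[_ sT] /= ts]. Qed.

Let coef_rev s : 0 <= s <= T ->
  [/\ Ar (T - s) = A s, Br (T - s) = B s, Cr (T - s) = C s, Dr (T - s) = D s &
     Rd (T - s) = R (s, s)].
Proof. by move=> sT; rewrite /Ar /Br /Cr /Dr /Rd subKr cl_id. Qed.

Lemma riccati_existence : exists P : K * K -> V,
  riccati_solution A C B D G Q R T P /\ {within `[0, T], continuous (Theta C B D R P)}.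
Proof.
have [X [u [Xc X0 dX uc uE]]] := reversed_existence.
pose P (z : K * K) := X z.1 (T - z.2).
have ThE s : 0 <= s <= T -> u (T - s) = Theta C B D R P s.
  move=> sT; rewrite uE ?rev// subKr.
  by have [_ -> -> -> ->] := coef_rev sT.
exists P; split; [split; [split|split]|].
- have Pc : {within Delta 0 T, continuous (fun z : K * K => X z.1 (cl (T - z.2)))}.
    apply: continuous_subspaceT => z.
    apply: (@continuous_comp _ _ _ (fun z : K * K => (z.1, T - z.2))
      (fun z : K * K => X z.1 (cl z.2))); last exact: Xc.
    apply: (continuous_pair (f := fun z : K * K => z.1) (g := fun z : K * K => T - z.2)).
      exact: cvg_fst.
    by apply: cvgB; [exact: cvg_cst|exact: cvg_snd].
  apply: subspace_eq_continuous Pc => -[t s]; rewrite inE => -[_ /= sT _].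
  by congr (X t _); exact: cl_id (rev sT).
- move=> [t s] /DeltaE[t0 ts sT]; apply: (dX t (T - s) _).1.
  by apply: rev; rewrite sT (le_trans t0).
- move=> t s /DeltaE[t0 ts sT].
  have s0T : 0 <= s <= T by rewrite sT (le_trans t0).
  have [_ dXts] := dX t (T - s) (rev s0T).
  exists (- rhs (A s) (B s) (C s) (D s) (Q (t, s)) (R (t, s)) (P (t, s)) (Theta C B D R P s)).
    apply: mx_derive_has_derivative_in.
    rewrite ThE// /Qr /Rr tri_id// in dXts.
    have [EA EB EC ED _] := coef_rev s0T; rewrite EA EB EC ED in dXts.
    exact: (mx_derive_reverse dXts).
  by apply/eqP; rewrite -!addrA addrC addr_eq0 opprK /rhs -!addrA.
- move=> t tT; rewrite /P /= subrr X0 cl_id//.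
- have uc' : {within `[0, T], continuous (fun s => u (T - s))}.
    apply: continuous_subspaceT => s.
    apply: (@continuous_comp _ _ _ (fun s => T - s) u); last exact: uc.
    by apply: cvgB; [exact: cvg_cst|exact: cvg_id].
  apply: subspace_eq_continuous uc' => s; rewrite inE/= in_itv/=; exact: ThE.
Qed.

(** Composition with [tri] moves the question to the square, a product of compact intervals. *)
Let triangle_bound (f : K * K -> V) : {within Delta 0 T, continuous f} ->
  exists2 L : K, 0 <= L & forall t s, Delta 0 T (t, s) -> `|f (t, s)| <= L.
Proof.
move=> fc; have cS : compact (`[0, T] `*` `[0, T] : set (K * K)).
  by apply: compact_setX; exact: segment_compact.
have [L L0 fL] := compact_norm_bound cS
  (continuous_subspaceT (continuous_within_comp fc tri_cont Delta_tri)).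
exists L => // t s /DeltaE[t0 ts sT]; rewrite -(tri_id t0 ts sT); apply: fL.
by split; rewrite /= in_itv/= ?t0 ?(le_trans ts)// rev// sT (le_trans t0).
Qed.

Let slice_cont (f : K * K -> V) t s : {within Delta 0 T, continuous f} ->
  0 <= t -> t <= s -> {within `[s, T], continuous (fun r => f (t, r))}.
Proof.
move=> fc t0 ts.
have fc' : {within `[s, T], continuous (fun r => f (tri (t, T - r)))}.
  apply: continuous_subspaceT => r.
  apply: (@continuous_comp _ _ _ (fun r : K => (t, T - r)) (fun z => f (tri z))).
    apply: (continuous_pair (f := fun=> t) (g := fun r : K => T - r)).
      exact: cvg_cst.
    by apply: cvgB; [exact: cvg_cst|exact: cvg_id].
  exact: continuous_within_comp fc tri_cont Delta_tri (t, T - r).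
apply: subspace_eq_continuous fc' => r; rewrite inE/= in_itv/= => /andP[sr rT].
by congr (f _); apply: tri_id => //; exact: le_trans ts sr.
Qed.

(** Where [M] bounds a solution no truncation is active, so the solution also satisfies the cut-off
    equation, whose field is globally Lipschitz. *)
Let solution_derive (P : K * K -> V) c M t s : 0 <= M ->
  (forall S : 'M[K]_m, delta%:M <=L S -> c <= \det S ^+ 2) ->
  riccati_solution A C B D G Q R T P ->
  (forall t s, Delta 0 T (t, s) -> `|P (t, s)| <= M) ->
  0 <= t -> t < s < T ->
  mx_derive (fun r => P (t, r)) s (- F c M M (t, T - s) (P (t, s), P (s, s))).
Proof.
move=> M0 cdet [[Pc Ppos] [Peq _]] PM t0 /andP[ts sT].
have s0 : 0 <= s by rewrite (le_trans t0)// ltW.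
have Dts : Delta 0 T (t, s).
  by split => /=; [rewrite t0 (ltW (lt_trans ts sT))|rewrite s0 ltW|exact: ltW].
have Dss : Delta 0 T (s, s) by split => /=; rewrite ?s0 ?(ltW sT).
have s0T : 0 <= s <= T by rewrite s0 ltW.
have [dP dPts dPE] := Peq t s Dts.
have tsT : t < s < T by rewrite ts.
have := has_derivative_in_mx_derive tsT dPts.
apply: mx_derive_ext => //.
have [l [_ thE l1]] := trunc_feedbackE (Br (T - s)) (Cr (T - s)) (Dr (T - s))
  delta_gt0 M0 cdet (Rd_pos (T - s)) (Ppos (s, s) Dss).
rewrite l1 ?scale1r in thE; last exact: PM.
rewrite /F [cut _ _]cut_id; last exact: PM.
rewrite /th [X in rhs _ _ _ _ _ _ _ X]thE /Qr /Rr tri_id ?(ltW ts) ?(ltW sT)//.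
have [-> -> -> -> ->] := coef_rev s0T.
apply/eqP; rewrite -addr_eq0 /rhs !addrA; apply/eqP; exact: dPE.
Qed.

(** One radius [M] serves both solutions. The estimate at (t, s) uses the induction hypothesis at
    (t, r) and (r, r) for r between s and T, all inside the triangle; each round halves the weighted
    distance. *)
Lemma riccati_uniqueness (P P' : K * K -> V) :
  riccati_solution A C B D G Q R T P -> riccati_solution A C B D G Q R T P' ->
  forall t s, Delta 0 T (t, s) -> P' (t, s) = P (t, s).
Proof.
move=> sP sP' t0 s0 D0.
have [c c0 cdet] := coercive_det m delta_gt0.
have Pc := sP.1.1; have P'c := sP'.1.1.
have [M1 M10 PM1] := triangle_bound Pc.
have [M2 M20 PM2] := triangle_bound P'c.
pose M := M1 + M2; have M0 : 0 <= M by rewrite addr_ge0.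
have PM t s : Delta 0 T (t, s) -> `|P (t, s)| <= M.
  by move=> h; rewrite (le_trans (PM1 t s h))// lerDl.
have P'M t s : Delta 0 T (t, s) -> `|P' (t, s)| <= M.
  by move=> h; rewrite (le_trans (PM2 t s h))// lerDr.
have [_ _ [L L0 FL]] := BLM_norm (BL_F c0 M0 M0).
have main k : forall t s, Delta 0 T (t, s) ->
    `|P' (t, s) - P (t, s)| <= 2 * M / 2 ^+ k * expR (2 * L * (T - s)).
  elim: k => [|k IH] t s Dts; have [t_ge0 ts sT] := DeltaE Dts.
    rewrite expr0 divr1 (@le_trans _ _ (2 * M))//.
      by rewrite (le_trans (ler_normB _ _))// mulr_natl mulr2n lerD ?P'M ?PM.
    by rewrite ler_peMr ?mulr_ge0// expRM_ge1 ?mulr_ge0 ?subr_ge0// ltW.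
  pose w := 2 * M / 2 ^+ k.+1.
  have wE : 2 * M / 2 ^+ k = 2 * w.
    by rewrite /w exprS; field; rewrite expf_neq0 ?pnatr_eq0.
  have w0 : 0 <= w by rewrite divr_ge0 ?mulr_ge0// exprn_ge0.
  (* The weight decreases in [r], so its negative is the increasing majorant that the mean value
     inequality on [[s, T]] requires. *)
  have expE r : - (w * expR (2 * L * T)) * expR (- (2 * L) * r) =
      - (w * expR (2 * L * (T - r))).
    by rewrite mulNr -[w * _ * _]mulrA -expRD mulrBr mulNr.
  have inD r : r \in `]s, T[ -> t < r < T.
    by rewrite in_itv/= => /andP[sr ->]; rewrite (le_lt_trans ts).
  have dd r (rs : r \in `]s, T[) := mx_deriveB
    (solution_derive M0 cdet sP' P'M t_ge0 (inD r rs))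
    (solution_derive M0 cdet sP PM t_ge0 (inD r rs)).
  have := mx_mvt_le sT _ _ dd
    (fun r _ => is_derive_exp (- (w * expR (2 * L * T))) (- (2 * L)) r).
  rewrite (sP.2.2 t) ?(sP'.2.2 t) ?t_ge0 ?(le_trans ts)// subrr !expE.
  rewrite subrr mulr0 expR0 mulr1 sub0r normrN => h.
  apply: (le_trans (h _ _ _)); last by rewrite opprK addrC gerBl.
  - by move=> r; apply: cvgB; [exact: (slice_cont P'c)|exact: (slice_cont Pc)].
  - apply: continuous_in_subspaceT => y _.
    have /derivable1_diffP/differentiable_continuous hc := @ex_derive _ _ _ _ _ _ _
      (is_derive_exp (- (w * expR (2 * L * T))) (- (2 * L)) y).
    exact: hc.
  - move=> r rs; have /andP[tr rT] := inD r rs.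
    have r0 : 0 <= r by rewrite (le_trans t_ge0)// ltW.
    rewrite -opprD normrN (le_trans (FL _ _ _))// expE mulrNN.
    rewrite [leRHS](_ : _ = L * (2 * w * expR (2 * L * (T - r)))); last by ring.
    rewrite ler_pM2l// -wE; apply: prod_norm_le; apply: IH; split;
      by rewrite /= ?t_ge0 ?r0 ?(ltW tr) ?(ltW rT)// (le_trans (ltW tr))// ltW.
apply/eqP; rewrite -subr_eq0 -normr_le0.
apply: (@le_geometric_slack _ _ _ (2 * M * expR (2 * L * (T - s0)))) => k.
by rewrite add0r mulrAC; exact: main.
Qed.

End Equilibrium.

Theorem theorem4p2 (K : realType) (n m : nat) (T : K)
  (A C : K -> 'M[K]_n) (B D : K -> 'M[K]_(n, m)) (G : K -> 'M[K]_n)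
  (Q : K * K -> 'M[K]_n) (R : K * K -> 'M[K]_m)
  (delta : K) (Qhat : 'M[K]_n) (Rhat : 'M[K]_m) (Ghat : 'M[K]_n)
  (T_gt0 : 0 < T)
  (A_cont : {within `[0, T], continuous A})
  (C_cont : {within `[0, T], continuous C})
  (B_cont : {within `[0, T], continuous B})
  (D_cont : {within `[0, T], continuous D})
  (G_cont : cont_fun `[0, T] Sym G)
  (Q_cont : cont_fun (`[0, T] `*` `[0, T]) Sym Q)
  (R_cont : cont_fun (`[0, T] `*` `[0, T]) Sym R)
  (delta_gt0 : 0 < delta)
  (pos : forall t s : K, 0 <= t -> t <= s -> s <= T ->
    [/\ 0 <=L Q (t, s), delta%:M <=L R (t, s) & 0 <=L G t])
  (Qhat_pos : posdef Qhat) (Rhat_pos : posdef Rhat) (Ghat_pos : posdef Ghat)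
  (mono : forall t r s : K, 0 <= t -> t <= r -> r <= s -> s <= T ->
    [/\ Q (t, s) <=L Q (r, s) /\ Q (r, s) <=L Qhat,
        R (t, s) <=L R (r, s) /\ R (r, s) <=L Rhat &
        G t <=L G r /\ G r <=L Ghat])
  (G_C1 : C1_fun `[0, T] G)
  (Q_C1 : C1_first_var T Q)
  (R_C1 : C1_first_var T R) :
  exists P : K * K -> 'M[K]_n,
    [/\ riccati_solution A C B D G Q R T P,
        forall P' : K * K -> 'M[K]_n,
          riccati_solution A C B D G Q R T P' ->
          forall t s : K, Delta 0 T (t, s) -> P' (t, s) = P (t, s) &
        {within `[0, T], continuous (Theta C B D R P)}].
Proof.
have pos' t s : 0 <= t -> t <= s -> s <= T ->
    [/\ SymPos (Q (t, s)), delta%:M <=L R (t, s) & SymPos (G t)].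
  move=> t0 ts sT; have [q r g] := pos t s t0 ts sT.
  by rewrite /loewner_le !subr0 in q g; split.
have mono' t r s : 0 <= t -> t <= r -> r <= s -> s <= T ->
    [/\ Q (t, s) <=L Q (r, s), R (t, s) <=L R (r, s) & G t <=L G r].
  by move=> t0 tr rs sT; have [[q _] [r' _] [g _]] := mono t r s t0 tr rs sT; split.
have [P [solP ThP]] := riccati_existence T_gt0 A_cont C_cont B_cont D_cont
  G_cont.1 Q_cont.1 R_cont.1 delta_gt0 pos' mono'.
exists P; split => // P' solP'.
exact: riccati_uniqueness T_gt0 A_cont C_cont B_cont D_cont
  Q_cont.1 R_cont.1 delta_gt0 pos' _ _ solP solP'.
Qed.
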